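(* For $\lambda>0$ let $\mathcal P_\lambda$ be the homogeneous Poisson point process of rate $\lambda$ in the Clifford torus $T^2\subset\mathbb E^4$, and let $\bar v$ be the mean valence of a vertex of $\mathrm{conv}\,\mathcal P_\lambda$. Then $\mathsf E\,\bar v = O^*(\ln\lambda)$ as $\lambda\to\infty$.
   Context: The Clifford torus is $T^2=\{(\cos\phi,\sin\phi,\cos\psi,\sin\psi):-\pi<\phi,\psi\le\pi\}\subset\mathbb E^4$, with its natural (locally Euclidean, flat) Borel area measure $mes_2$, $mes_2(T^2)=4\pi^2$. The homogeneous Poisson point process $\mathcal P_\lambda$ of rate $\lambda>0$ is the random point set in $T^2$ such that for every Borel set $A\subset T^2$ the random variable $n(A)=|\mathcal P_\lambda\cap A|$ has the Poisson distribution with parameter $\lambda\, mes_2(A)$ (the standard Poisson point process with intensity measure $\lambda\, mes_2$). A polytope in $\mathbb E^4$ is called generic if it is a simplicial 4-polytope, or a simplex of dimension at most 3, or empty; $\mathrm{conv}\,\mathcal P_\lambda$ is almost surely generic. The $f$-vector $(f_0,f_1,f_2,f_3)$ of a 4-polytope has $f_i$ equal to the number of $i$-faces. By convention the $f$-vector of a 3-dimensional simplex is $(4,6,4,2)$, of a 2-dimensional simplex $(3,3,1,0)$, of a segment $(2,1,0,0)$, of a point $(1,0,0,0)$, and of the empty polytope $(0,0,0,0)$. The mean valence of a vertex of a polytope with $f$-vector $(f_0,f_1,f_2,f_3)$ is $\bar v=\frac{2f_1}{f_0}$ if $f_0\ne0$ and $\bar v=0$ if $f_0=0$. For functions $F_1,F_2$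 of $\lambda$, $F_1=O^*(F_2)$ means $\limsup_{\lambda\to\infty}\max\left(\left|\frac{F_1}{F_2}\right|,\left|\frac{F_2}{F_1}\right|\right)<\infty$. *)

(* Defs.v *)
From HB Require Import structures.
From mathcomp Require Import all_boot all_order all_algebra.
From mathcomp Require Import finmap.
From mathcomp Require Import all_classical all_reals all_analysis.

Set Implicit Arguments.
Unset Strict Implicit.
Unset Printing Implicit Defensive.

Import Order.TTheory GRing.Theory Num.Theory.
Import numFieldNormedType.Exports.

Local Open Scope classical_set_scope.
Local Open Scope ring_scope.

Section Polytopes.
Context {R : realType}.
Local Notation E4 := ('rV[R]_4).

Definition convex_hull (X : set E4) : set E4 :=
  smallest (@convex_set R E4) X.

(* With u = 0 and c = 0 this makes K an (improper) face of itself. *)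
Definition is_face (K F : set E4) : Prop :=
  exists (u : E4) (c : R),
    (forall x, K x -> (u *m x^T) 0 0 <= c) /\
    F = K `&` [set x | (u *m x^T) 0 0 = c].

(* The rows of p are affinely independent iff the points (p_i, 1) of R^5 are
   linearly independent. *)
Definition affinely_independent (k : nat) (p : 'M[R]_(k, 4)) : bool :=
  row_free (row_mx p (const_mx 1 : 'cV[R]_k)).

Definition has_dim (F : set E4) (i : nat) : Prop :=
  (exists p : 'M[R]_(i.+1, 4),
     (forall j, F (row j p)) /\ affinely_independent p) /\
  (forall p : 'M[R]_(i.+2, 4),
     (forall j, F (row j p)) -> ~~ affinely_independent p).

(* The number f_i of i-faces (0 if there are infinitely many).  Since K counts
   as a face of itself, (f_0, f_1) is (2, 1) for a segment, (1, 0) for a point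
   and (0, 0) for the empty set, as well as (3, 3) for a triangle and (4, 6)
   for a tetrahedron.  The convention f_3 = 2 for a tetrahedron is not
   reflected here: only f_0 and f_1 enter the mean valence. *)
Definition face_number (K : set E4) (i : nat) : nat :=
  #|` fset_set [set F : set E4 | is_face K F /\ has_dim F i]|%fset.

Definition mean_valence (K : set E4) : R :=
  if face_number K 0 == 0%N then 0
  else 2 * (face_number K 1)%:R / (face_number K 0)%:R.

End Polytopes.

Section CliffordTorus.
Context {R : realType}.
Local Notation E4 := ('rV[R]_4).

Definition clifford_map (t : R * R) : E4 :=
  \row_(i < 4) [:: cos t.1; sin t.1; cos t.2; sin t.2]`_i.

Definition angle_square : set (R * R) := `]- pi, pi] `*` `]- pi, pi].

Definition clifford_torus : set E4 := clifford_map @` angle_square.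

Definition borel_in_torus (A : set E4) : Prop :=
  <<s (@open E4) >> A /\ A `<=` clifford_torus.

(* clifford_map is a local isometry, injective on angle_square, so that flat
   area on the torus is d phi d psi. *)
Definition mes2 (A : set E4) : \bar R :=
  (lebesgue_measure \x lebesgue_measure)%E
    (angle_square `&` clifford_map @^-1` A).

End CliffordTorus.

Section PoissonProcess.
Context {R : realType} d (Omega : measurableType d).
Local Notation E4 := ('rV[R]_4).

(* The event n(A) = k. *)
Definition count_event (X : Omega -> set E4) (A : set E4) (k : nat) :
    set Omega :=
  [set w | ((X w `&` A) #= `I_k)%card].

(* The law of n(A) is given by [poisson_prob], whose nat argument is irrelevant,
   and not by [poisson_pmf], whose value at rate 0 is 1 for every k: null sets A
   must get the Dirac mass at 0. *)
Definition clifford_poisson_process (P : probability Omega R) (l : R)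
    (X : Omega -> set E4) : Prop :=
  [/\ forall w, X w `<=` clifford_torus,
      forall A, borel_in_torus A -> forall k,
        measurable (count_event X A k) /\
        P (count_event X A k) = poisson_prob (l * fine (mes2 A)) k [set k]
    & forall (m : nat) (A : 'I_m -> set E4) (k : 'I_m -> nat),
        (forall i, borel_in_torus (A i)) -> trivIset setT A ->
        P (\bigcap_i count_event X (A i) (k i)) =
        (\prod_(i < m) P (count_event X (A i) (k i)))%E].

End PoissonProcess.

(* F1 = O^*(F2) as the argument tends to +oo.  In \bar R one has x / 0 = +oo or
   -oo for x != 0, so that a vanishing denominator is not silently accepted
   unless both functions vanish. *)
Definition bigOstar {R : realType} (F1 F2 : R -> \bar R) : Prop :=
  (limf_esup (fun l => maxe `|F1 l / F2 l| `|F2 l / F1 l|) (pinfty_nbhs R)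
     < +oo)%E.

(* Main.v *)
(* All points lie on a sphere, so every point is a vertex, and the edges are the pairs
   of points on the boundary of a cap of the torus without points in its interior.  In
   angle coordinates a cap [a cos(phi - alpha) + b cos(psi - beta) >= c] is, up to
   constants, an axis-parallel box of arbitrary proportions.  So an edge needs an empty
   box, of area about 1 / lambda, next to both of its endpoints.  There are about
   log lambda dyadic proportions of such a box, and each of them contributes O(lambda)
   edges in expectation.

   Upper bound: an edge lies in a bounded neighbourhood of an empty cell of a dyadic grid
   of scale [(i, j)], [i, j <= log2 lambda + O(1)], or in a strip of width O(1 / lambda).
   A cell of mean m is empty and has a pair of points around it with expectation
   O(m ^ 2 exp(- m)), and the sum over all cells is O(lambda log lambda).
   Lower bound: for each [i + j = k ~ log2 lambda], a positive proportion of the cells of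
   scale [(i, j)] has exactly two points around it, in opposite corners, and these span
   an edge.  The number of vertices is of order lambda by elementary Poisson tail bounds.

   The mean valence need not be measurable, hence it is compared pointwise with
   measurable functions of counts of points. *)
Require Import Defs.
From HB Require Import structures.
From mathcomp Require Import all_boot all_order all_algebra.
From mathcomp Require Import finmap.
From mathcomp Require Import all_classical all_reals all_analysis.
From mathcomp Require Import measurable_realfun.
From mathcomp Require Import ring lra zify.

Set Implicit Arguments.
Unset Strict Implicit.
Unset Printing Implicit Defensive.

Import Order.TTheory GRing.Theory Num.Theory.
Import numFieldNormedType.Exports.

Local Open Scope classical_set_scope.
Local Open Scope ring_scope.

(** * Faces of convex hulls *)

Section Convexity.
Context {R : realType}.
Local Notation E4 := ('rV[R]_4).
Implicit Types (X C F K : set E4) (u x y p q : E4) (c : R).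

(** The two angles decouple by averaging. If [a cos(x - alpha) + b cos(y - beta)] takes the value
    [c] at both endpoints of an edge, it exceeds [c] wherever each cosine separately exceeds the
    mean of its two endpoint values. Each of these one-variable conditions holds on an arc
    comparable to the distance of the endpoints from its centre, and the product of two such arcs
    must be free of points.

    The valence is a quotient of dependent random numbers [f_1] and [f_0]. For the upper bound [f_0]
    is replaced by a threshold near a quarter of its mean; below it the trivial [f_1 <= f_0 ^ 2]
    meets an exponentially small probability. For the lower bound each event prescribes the counts
    on a partition of the whole torus, and so carries its own bound on [f_0].

    Pairs are counted through second factorial moments, and the empty cell is cut out of its
    neighbourhood so that the two counts are independent. Edges found at different scales are
    distinct because the extent of a pair lies between half the width and the full width of its
    cell. *)

Definition dot u x : R := (u *m x^T) 0 0.

Lemma dotDr u x y : dot u (x + y) = dot u x + dot u y.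
Proof. by rewrite /dot linearD mulmxDr mxE. Qed.

Lemma dotZr u a x : dot u (a *: x) = a * dot u x.
Proof. by rewrite /dot linearZ -scalemxAr mxE. Qed.

Lemma dot0r u : dot u 0 = 0.
Proof. by rewrite -(scale0r 0) dotZr mul0r. Qed.

Lemma dotC u x : dot u x = dot x u.
Proof. by rewrite /dot -[u in LHS]trmxK -trmx_mul mxE. Qed.

Lemma dotNr u x : dot u (- x) = - dot u x.
Proof. by rewrite -scaleN1r dotZr mulN1r. Qed.

Lemma dot_sumE u x : dot u x = \sum_(i < 4) u 0 i * x 0 i.
Proof. by rewrite /dot mxE; apply: eq_bigr => i _; rewrite mxE. Qed.

Lemma dot_gt0 x : x != 0 -> 0 < dot x x.
Proof.
rewrite dot_sumE => x0; rewrite lt_neqAle sumr_ge0 ?andbT; last first.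
  by move=> i _; rewrite -expr2 sqr_ge0.
apply: contraNneq x0 => /esym/eqP; rewrite psumr_eq0; last first.
  by move=> i _; rewrite -expr2 sqr_ge0.
move=> /allP x0; apply/eqP/rowP => i; rewrite mxE.
by have := x0 i (mem_index_enum i); rewrite mulf_eq0 orbb => /eqP.
Qed.

Lemma convex_setE C :
  @convex_set R E4 C <->
  forall x y (t : R), C x -> C y -> 0 < t -> t < 1 -> C (t *: x + (1 - t) *: y).
Proof.
split=> [cC x y t Cx Cy t0 t1|H].
  have t01 : (0 <= t <= 1)%R by rewrite !ltW.
  have := cC x y (Itv01 (ltW t0) (ltW t1)); rewrite !inE => /(_ Cx Cy).
  by rewrite /conv /=.
apply/convex_setW => x y; rewrite !inE => Cx Cy k k0 k1; rewrite inE.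
exact: (H x y k%:num).
Qed.

Lemma convex_hull_convex X : @convex_set R E4 (convex_hull X).
Proof.
apply/convex_setE => x y t hx hy t0 t1 C [cC XC].
by move/convex_setE : (cC); apply => //; [apply: hx|apply: hy].
Qed.

Lemma sub_convex_hull X : X `<=` convex_hull X.
Proof. exact: sub_gen_smallest. Qed.

Lemma convex_hull_sub X C : @convex_set R E4 C -> X `<=` C -> convex_hull X `<=` C.
Proof. exact: smallest_sub. Qed.

Lemma convex_le u c : @convex_set R E4 [set x | dot u x <= c].
Proof.
apply/convex_setE => x y t /= hx hy t0 t1; rewrite dotDr !dotZr.
have : t * dot u x <= t * c by rewrite ler_wpM2l// ltW.
have : (1 - t) * dot u y <= (1 - t) * c by rewrite ler_wpM2l// subr_ge0 ltW.
lra.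
Qed.

Lemma convex_eq u c : @convex_set R E4 [set x | dot u x = c].
Proof.
by apply/convex_setE => x y t /= hx hy t0 t1; rewrite dotDr !dotZr hx hy; ring.
Qed.

(** A proper convex combination with one end strictly below the level is strictly below it. With [C]
    the hull of the points of [X] on a supporting hyperplane, the union contains [X] and therefore
    its hull. *)
Lemma convex_lt_or u c C : @convex_set R E4 C -> C `<=` [set x | dot u x = c] ->
  @convex_set R E4 ([set x | dot u x < c] `|` C).
Proof.
move=> /convex_setE cC Cu; apply/convex_setE => x y t hx hy t0 t1.
have le z : ([set x | dot u x < c] `|` C) z -> dot u z <= c.
  by case=> [/ltW//|/Cu/= ->].
case: (hx) => [hx'|Cx]; last case: (hy) => [hy'|Cy].
- left; rewrite /= dotDr !dotZr.
  have : t * dot u x < t * c by rewrite ltr_pM2l.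
  have : (1 - t) * dot u y <= (1 - t) * c by rewrite ler_wpM2l ?subr_ge0 ?(ltW t1)// le.
  lra.
- left; rewrite /= dotDr !dotZr.
  have : t * dot u x <= t * c by rewrite ler_wpM2l ?(ltW t0)// le.
  have : (1 - t) * dot u y < (1 - t) * c by rewrite ltr_pM2l ?subr_gt0.
  lra.
- by right; apply: cC.
Qed.

Lemma supporting_face X u c : X `<=` [set x | dot u x <= c] ->
  is_face (convex_hull X) (convex_hull X `&` [set x | dot u x = c]).
Proof.
move=> Xu; exists u, c; split=> //; exact: (convex_hull_sub (@convex_le u c) Xu).
Qed.

(** A face is thus determined by the points of [X] on it. Finiteness of the set of faces and the
    recognition of edges both rest on this. *)
Lemma face_hull X F : is_face (convex_hull X) F -> F = convex_hull (X `&` F).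
Proof.
move=> [u [c [Ku ->]]]; apply/seteqP; split=> [x [Kx ux]|].
  suff: ([set x | dot u x < c] `|`
      convex_hull (X `&` (convex_hull X `&` [set x | dot u x = c]))) x.
    by case=> //=; rewrite [dot _ _]ux ltxx.
  move: x Kx {ux}; apply: convex_hull_sub.
    apply: convex_lt_or; first exact: convex_hull_convex.
    by apply: convex_hull_sub => [|x [_ []//]]; exact: convex_eq.
  move=> x Xx; have Kx := sub_convex_hull Xx.
  have := Ku _ Kx; rewrite le_eqVlt => /orP[/eqP xc|]; last by left.
  by right; apply: sub_convex_hull; split.
apply: convex_hull_sub => [|x [_ //]].
apply/convex_setE => x y t [Kx ux] [Ky uy] t0 t1; split.
  by have /convex_setE := @convex_hull_convex X; apply.
by have /convex_setE := @convex_eq u c; apply.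
Qed.

Lemma affinely_independentP k (p : 'M[R]_(k, 4)) :
  affinely_independent p <->
  forall v : 'I_k -> R, \sum_i v i *: row i p = 0 -> \sum_i v i = 0 ->
    forall i, v i = 0.
Proof.
have E (v : 'rV[R]_k) : v *m row_mx p (const_mx 1 : 'cV[R]_k) =
    row_mx (\sum_i v 0 i *: row i p) (\row_(_ < 1) \sum_i v 0 i).
  rewrite mul_mx_row mulmx_sum_row; congr row_mx.
  apply/rowP => j; rewrite !mxE; apply: eq_bigr => i _; by rewrite mxE mulr1.
split=> [fp v v1 v2 i|H].
  have : (\row_i v i) *m row_mx p (const_mx 1 : 'cV[R]_k) == 0.
    rewrite E row_mx_eq0; apply/andP; split; apply/eqP.
      by rewrite -[RHS]v1; apply: eq_bigr => j _; rewrite mxE.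
    apply/rowP => j; rewrite !mxE -[RHS]v2; apply: eq_bigr => a _.
    by rewrite mxE.
  by rewrite mulmx_free_eq0// => /eqP/rowP/(_ i); rewrite !mxE.
apply: inj_row_free => v /eqP; rewrite E row_mx_eq0 => /andP[/eqP v1 /eqP v2].
apply/rowP => i; rewrite mxE; apply: (H (v 0)) => //.
by have /rowP/(_ 0) := v2; rewrite !mxE.
Qed.

Definition points_mx (s : seq E4) : 'M[R]_(size s, 4) := \matrix_(i < size s) nth 0 s i.

Lemma row_points_mx s i : row i (points_mx s) = nth 0 s i.
Proof. by rewrite /points_mx rowK. Qed.

Lemma affinely_independent1 (p : 'M[R]_(1, 4)) : affinely_independent p.
Proof.
by apply/affinely_independentP => v _; rewrite big_ord1 => v0 i; rewrite ord1.
Qed.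

Lemma affinely_independent2 p q : p != q -> affinely_independent (points_mx [:: p; q]).
Proof.
move=> pq; apply/affinely_independentP => v.
rewrite !big_ord_recl !big_ord0 !row_points_mx /= !addr0 => v1 /eqP.
rewrite addr_eq0 => /eqP v2; rewrite v2 scaleNr addrC -scalerBr in v1.
have v0 : v (lift ord0 ord0) = 0.
  by move/eqP : v1; rewrite scaler_eq0 subr_eq0 (eq_sym q) (negbTE pq) orbF => /eqP.
move=> i; case: (unliftP ord0 i) => [j|] ->; last by rewrite v2 v0 oppr0.
by rewrite ord1.
Qed.

Lemma affinely_dependent_rows k (p : 'M[R]_(k, 4)) i j :
  i != j -> row i p = row j p -> ~~ affinely_independent p.
Proof.
move=> ij pij; apply/negP => /affinely_independentP H.
pose v a : R := (a == i)%:R - (a == j)%:R.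
have /eqP : v i = 0.
  apply: H.
    rewrite (bigD1 i)//= (bigD1 j) 1?eq_sym//= big1 => [|a /andP[/negbTE ai /negbTE aj]].
      by rewrite /v !eqxx (negbTE ij) eq_sym (negbTE ij) pij /= mulr1n mulr0n subr0 sub0r scale1r scaleN1r addr0 subrr.
    by rewrite /v ai aj subrr scale0r.
  rewrite (bigD1 i)//= (bigD1 j) 1?eq_sym//= big1 => [|a /andP[/negbTE ai /negbTE aj]].
    by rewrite /v !eqxx (negbTE ij) eq_sym (negbTE ij) /= mulr1n mulr0n subr0 sub0r addr0 subrr.
  by rewrite /v ai aj subrr.
by rewrite /v eqxx (negbTE ij) subr0 oner_eq0.
Qed.

Lemma has_dim0P F : has_dim F 0 <-> exists p, F = [set p].
Proof.
split=> [[[m [Fm _]] H]|[p ->]].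
  exists (row 0 m); apply/seteqP; split=> [x Fx|x ->]; last exact: Fm.
  apply: contrapT => /eqP xm.
  have h j : F (row j (points_mx [:: x; row 0 m])).
    by rewrite row_points_mx; case: j => -[|[|//]] ? /=.
  by have := H _ h; rewrite affinely_independent2.
split.
  exists p; split; last exact: affinely_independent1.
  by move=> j; rewrite ord1; apply/rowP => i; rewrite !mxE.
move=> m mp; apply: (@affinely_dependent_rows _ _ ord0 (lift ord0 ord0)) => //.
by rewrite !mp.
Qed.

Lemma has_dim1_two F : has_dim F 1 -> exists p q, [/\ F p, F q & p != q].
Proof.
move=> [[m [Fm mi]] _]; exists (row 0 m), (row (lift ord0 ord0) m); split=> //.
apply/negP => /eqP E.
by move: mi; apply/negP; apply: affinely_dependent_rows E.
Qed.

Lemma convex_hull2 p q :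
  convex_hull [set p; q] `<=` [set x | exists a : R, x = a *: p + (1 - a) *: q].
Proof.
apply: convex_hull_sub => [|x [] ->]; last 2 first.
- by exists 1; rewrite scale1r subrr scale0r addr0.
- by exists 0; rewrite subr0 scale1r scale0r add0r.
apply/convex_setE => x y t [a ->] [b ->] t0 t1; exists (t * a + (1 - t) * b).
apply/rowP => i; rewrite !mxE; ring.
Qed.

Lemma has_dim_segment p q : p != q -> has_dim (convex_hull [set p; q]) 1.
Proof.
move=> pq; split.
  exists (points_mx [:: p; q]); split; last exact: affinely_independent2.
  move=> j; have -> : row j (points_mx [:: p; q]) = nth 0 [:: p; q] j.
    exact: row_points_mx.
  apply: sub_convex_hull.
  by case: j => -[|[|//]] ? /=; [left|right].
move=> m mF.
pose i0 : 'I_3 := ord0; pose i1 : 'I_3 := lift ord0 ord0.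
pose i2 : 'I_3 := lift ord0 (lift ord0 ord0).
have [a0 e0] := convex_hull2 (mF i0); have [a1 e1] := convex_hull2 (mF i1).
have [a2 e2] := convex_hull2 (mF i2).
have [a01|a01] := eqVneq a0 a1.
  by apply: (@affinely_dependent_rows _ _ i0 i1) => //; rewrite e0 e1 a01.
apply/negP => /affinely_independentP H.
(* The affine dependence of three points of a line with parameters [a0], [a1], [a2]; its last
   coefficient is nonzero as [a0 != a1]. *)
pose v (i : 'I_3) := nth 0 [:: a1 - a2; a2 - a0; a0 - a1] i.
have : v i2 = 0.
  apply: H; rewrite !big_ord_recl !big_ord0 /v/= addr0; last by ring.
  rewrite -!/i0 -!/i1 -!/i2 e0 e1 e2; apply/rowP => j; rewrite !mxE; ring.
by rewrite /v /= => /eqP; rewrite subr_eq0 (negbTE a01).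
Qed.

(** A line meets a sphere in at most two points. On the sphere the squared length [A] of [q - p] is
    [- 2 p.(q - p)], and likewise [B] for [r - p]. A dependence [v1 (q - p) + v2 (r - p) = 0] paired
    with [p] gives [v1 A + v2 B = 0], and comparing lengths gives [v1^2 A = v2^2 B]; if [v2 != 0]
    these force [A = B] and then [q = r]. *)
Lemma affinely_independent3_sphere p q r (c : R) :
  dot p p = c -> dot q q = c -> dot r r = c -> p != q -> p != r -> q != r ->
  affinely_independent (points_mx [:: p; q; r]).
Proof.
move=> pc qc rc pq pr qr; apply/affinely_independentP => v.
rewrite !big_ord_recl !big_ord0 !row_points_mx /= !addr0.
set v0 := v ord0; set v1 := v (lift ord0 ord0); set v2 := v (lift _ (lift _ _)).
move=> e1 e2.
have v0E : v0 = - (v1 + v2) by apply/eqP; rewrite -addr_eq0 e2.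
have {}e1 : v1 *: (q - p) + v2 *: (r - p) = 0.
  by rewrite -[RHS]e1 v0E; apply/rowP => i; rewrite !mxE; ring.
pose A := dot (q - p) (q - p); pose B := dot (r - p) (r - p).
have A0 : 0 < A by rewrite dot_gt0// subr_eq0 eq_sym.
have B0 : 0 < B by rewrite dot_gt0// subr_eq0 eq_sym.
have AE : A = - (2 * dot p (q - p)).
  rewrite /A dotDr dotNr ![dot (q - p) _]dotC !dotDr !dotNr qc (dotC q p) pc; ring.
have BE : B = - (2 * dot p (r - p)).
  rewrite /B dotDr dotNr ![dot (r - p) _]dotC !dotDr !dotNr rc (dotC r p) pc; ring.
have f1 : v1 * A + v2 * B = 0.
  have := congr1 (dot p) e1; rewrite dotDr !dotZr dot0r => h.
  by rewrite AE BE -[RHS](mulr0 (- 2)) -h; ring.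
have f2 : v1 ^+ 2 * A = v2 ^+ 2 * B.
  have e3 : v1 *: (q - p) = - v2 *: (r - p).
    by apply/eqP; rewrite scaleNr -addr_eq0 e1.
  have := congr1 (fun x => dot x x) e3.
  by rewrite !dotZr ![dot (_ *: _) _]dotC !dotZr -/A -/B => h; lra.
have v20 : v2 = 0.
  apply/eqP; apply/negPn/negP => v2n.
  have : v2 ^+ 2 * B * (B - A) = 0.
    have : v1 ^+ 2 * A ^+ 2 = v2 ^+ 2 * B ^+ 2.
      have -> : v1 ^+ 2 * A ^+ 2 = (v1 * A) ^+ 2 by ring.
      have -> : v1 * A = - (v2 * B) by lra.
      by ring.
    have -> : v1 ^+ 2 * A ^+ 2 = v1 ^+ 2 * A * A by ring.
    by rewrite f2 => h; rewrite mulrBr; lra.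
  move/eqP; rewrite !mulf_eq0 (negbTE v2n) (gt_eqF B0)/= subr_eq0.
  move=> /eqP BA; rewrite BA -mulrDl in f1.
  move/eqP: f1; rewrite mulf_eq0 (gt_eqF A0) orbF addr_eq0 => /eqP f1.
  move: e1; rewrite f1 scaleNr addrC -scalerBr => /eqP.
  rewrite scaler_eq0 (negbTE v2n)/= opprB addrA subrK subr_eq0.
  by rewrite (eq_sym r) (negbTE qr).
have v10 : v1 = 0.
  by move: f1; rewrite v20 mul0r addr0 => /eqP; rewrite mulf_eq0 (gt_eqF A0) orbF => /eqP.
have v00 : v0 = 0 by rewrite v0E v10 v20 addr0 oppr0.
by move=> i; rewrite -[RHS]v00; case: (unliftP ord0 i) => [j|] -> //;
  case: (unliftP ord0 j) => [k|] ->; rewrite ?ord1 v00.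
Qed.

Lemma has_dim1_sphere F c p q r : has_dim F 1 ->
  dot p p = c -> dot q q = c -> dot r r = c ->
  F p -> F q -> F r -> p != q -> r = p \/ r = q.
Proof.
move=> [_ H] pc qc rc Fp Fq Fr pq; apply: contrapT => /not_orP[/eqP rp /eqP rq].
have := H (points_mx [:: p; q; r]).
rewrite (@affinely_independent3_sphere _ _ _ c)// 1?eq_sym//.
suff h : forall j, F (row j (points_mx [:: p; q; r])) by move=> /(_ h).
by move=> j; rewrite row_points_mx; case: j => -[|[|[|//]]] ?.
Qed.

End Convexity.

Lemma card_fset_set_le (T U : choiceType) (f : T -> U) (G : set T) (D : set U) :
  finite_set G -> finite_set D ->
  (forall x y, G x -> G y -> f x = f y -> x = y) ->
  (forall x, G x -> D (f x)) ->
  (#|` fset_set G| <= #|` fset_set D|)%N.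
Proof.
move=> fG fD finj GD.
have -> : #|` fset_set G| = #|` f @` fset_set G|%fset.
  apply/esym/card_in_imfset => x y /=.
  by rewrite !in_fset_set// !inE; exact: finj.
apply: fsubset_leq_card; apply/fsubsetP => y /imfsetP[x /=].
by rewrite !in_fset_set// !inE => Gx ->; apply: GD.
Qed.

(** * Vertices and edges of the hull of finitely many points of a sphere *)

Section Faces.
Context {R : realType}.
Local Notation E4 := ('rV[R]_4).
Variables (X : set E4) (r : R).
Hypothesis finX : finite_set X.
Hypothesis X_sphere : forall x, X x -> dot x x = r.
Local Notation K := (convex_hull X).

Lemma convex_hull_set0 : convex_hull (set0 : set E4) = set0.
Proof.
apply/seteqP; split=> //; apply: convex_hull_sub => //;
by apply/convex_setE => x y t [].
Qed.

Lemma convex_hull_set1 (p : E4) : convex_hull [set p] = [set p].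
Proof.
apply/seteqP; split; last exact: sub_convex_hull.
apply: convex_hull_sub => //; apply/convex_setE => x y t -> -> _ _ /=.
by rewrite -scalerDl addrC subrK scale1r.
Qed.

(** The tangent hyperplane at [p]: expanding the square of [x - p] gives the inequality, with
    equality only at [p]. *)
Lemma sphere_supporting p : X p -> X `<=` [set x | dot p x <= r].
Proof.
move=> Xp x Xx /=; have [->|xp] := eqVneq x p; first by rewrite X_sphere.
have : 0 < dot (x - p) (x - p) by rewrite dot_gt0// subr_eq0.
by rewrite dotDr dotNr ![dot (x - p) _]dotC !dotDr !dotNr (dotC x p) !X_sphere//; lra.
Qed.

Lemma sphere_supporting_eq p x : X p -> X x -> dot p x = r -> x = p.
Proof.
move=> Xp Xx e; apply/eqP/negPn/negP => xp.
have : 0 < dot (x - p) (x - p) by rewrite dot_gt0// subr_eq0.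
by rewrite dotDr dotNr ![dot (x - p) _]dotC !dotDr !dotNr (dotC x p) !X_sphere// e; lra.
Qed.

Lemma faces0E : [set F | is_face K F /\ has_dim F 0] = set1 @` X.
Proof.
apply/seteqP; split=> [F [KF /has_dim0P[p Fp]]|_ [p Xp <-]].
  have FE := face_hull KF.
  have [x [Xx Fx]] : X `&` F !=set0.
    apply/set0P/negP => /eqP e; move: FE; rewrite e convex_hull_set0 Fp => e'.
    by have : [set p] p by []; rewrite e'.
  by exists p => //; move: Xx Fx; rewrite Fp => Xx <-.
split; last by apply/has_dim0P; exists p.
have XF : X `&` (K `&` [set x | dot p x = r]) = [set p].
  apply/seteqP; split=> [x [Xx [_ /=]]|x ->]; first exact: sphere_supporting_eq.
  split=> //; split; first exact: sub_convex_hull.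
  by rewrite /= X_sphere.
have := supporting_face (sphere_supporting Xp).
by move=> h; have := face_hull h; rewrite XF convex_hull_set1 => <-.
Qed.

Lemma face_number0 : face_number K 0 = #|` fset_set X|.
Proof.
rewrite /face_number faces0E fset_set_image// card_in_imfset// => x y _ _ e.
by have : [set x] x by []; rewrite e.
Qed.

(** There are at most as many faces as subsets of [X]. Since [face_number] is 0 on infinite
    families, this is what makes it a true count. *)
Lemma finite_faces i : finite_set [set F | is_face K F /\ has_dim F i].
Proof.
apply: (@sub_finite_set _ _ ((fun Y : {fset E4} => convex_hull [set` Y]) @`
   [set` fpowerset (fset_set X)])).
  move=> F [KF _]; exists (fset_set (X `&` F)).
    have XF : X `&` F `<=` X by move=> x [].
    by rewrite /= fpowersetE; move: XF; rewrite fset_set_sub//; exact: finite_setIl.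
  rewrite fset_setK; first exact/esym/face_hull.
  exact: finite_setIl.
exact: finite_image.
Qed.

Lemma face1_two F : is_face K F -> has_dim F 1 ->
  exists p q, [/\ X p, X q, F p, F q & p != q].
Proof.
move=> KF F1; apply: contrapT => H.
have [a [b [Fa Fb ab]]] := has_dim1_two F1.
have FE := face_hull KF.
have [XF0|[x [Xx Fx]]] : X `&` F = set0 \/ X `&` F !=set0.
  by have [->|/set0P] := eqVneq (X `&` F) set0; [left|right].
  by move: Fa; rewrite FE XF0 convex_hull_set0.
have XF : X `&` F = [set x].
  apply/seteqP; split=> [y [Xy Fy]|y ->]; last by [].
  by apply: contrapT => /eqP yx; apply: H; exists x, y; split=> //; rewrite eq_sym.
by move: ab; rewrite FE XF convex_hull_set1 in Fa Fb; rewrite Fa Fb eqxx.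
Qed.

Lemma face1_pair F p q : is_face K F -> has_dim F 1 ->
  X p -> X q -> F p -> F q -> p != q -> F = convex_hull [set p; q].
Proof.
move=> KF F1 Xp Xq Fp Fq pq; rewrite {1}(face_hull KF); congr convex_hull.
apply/seteqP; split=> [x [Xx Fx]|x [] -> //].
have [->|->] := has_dim1_sphere F1 (X_sphere Xp) (X_sphere Xq) (X_sphere Xx) Fp Fq Fx pq.
  by left.
by right.
Qed.

(** An edge is recovered as the hull of the two points of [X] on it, so a choice of an ordered pair
    of endpoints for each edge is injective. *)
Lemma face_number1_le (D : set (E4 * E4)) : finite_set D ->
  (forall F p q, is_face K F -> has_dim F 1 -> X p -> X q -> F p -> F q -> p != q ->
    D (p, q)) ->
  (face_number K 1 <= #|` fset_set D|)%N.
Proof.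
move=> finD H.
have {}H F : exists pq : E4 * E4, is_face K F -> has_dim F 1 ->
    D pq /\ F = convex_hull [set pq.1; pq.2].
  have [[KF F1]|h] := pselect (is_face K F /\ has_dim F 1); last first.
    by exists (0, 0) => KF F1; exfalso; apply: h.
  have [p [q [Xp Xq Fp Fq pq]]] := face1_two KF F1.
  exists (p, q) => _ _; split; first exact: (H F).
  exact: face1_pair pq.
have [f Hf] := choice H.
apply: (card_fset_set_le (f := f)) => //; first exact: finite_faces.
  move=> F G [KF F1] [KG G1] FG.
  by rewrite (Hf F KF F1).2 FG -(Hf G KG G1).2.
by move=> F [KF F1]; have [] := Hf F KF F1.
Qed.

(** The functional attached to [i] exposes a face that meets [X] in exactly [p i] and [q i], so
    distinct pairs give distinct edges. *)
Lemma face_number1_ge (I : finType) (B : {set I}) (p q : I -> E4) :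
  (forall i, i \in B -> [/\ X (p i), X (q i), p i != q i &
     exists u c, [/\ X `<=` [set x | dot u x <= c], dot u (p i) = c, dot u (q i) = c &
       forall x, X x -> dot u x = c -> x = p i \/ x = q i]]) ->
  (forall i j, i \in B -> j \in B -> [set p i; q i] = [set p j; q j] -> i = j) ->
  (#|B| <= face_number K 1)%N.
Proof.
move=> H pq_inj.
have -> : #|B| = #|` fset_set [set i | i \in B]|.
  rewrite -card_finset; congr #|` _|; apply/fsetP => i.
  rewrite in_fset_set; last exact: finite_finset.
  by apply/idP/idP; rewrite !inE.
pose F i := convex_hull [set p i; q i].
have HF i : i \in B -> is_face K (F i) /\ X `&` F i = [set p i; q i].
  move=> /H[Xp Xq pq [u [c [Xu up uq Xpq]]]].
  have KF := supporting_face Xu.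
  have XF : X `&` (K `&` [set x | dot u x = c]) = [set p i; q i].
    apply/seteqP; split=> [x [Xx [_ /= ux]]|]; first exact: Xpq.
    by move=> x [->|->]; split=> //; split=> //; exact: sub_convex_hull.
  have FE : F i = K `&` [set x | dot u x = c] by rewrite /F -XF -(face_hull KF).
  by rewrite FE.
apply: (card_fset_set_le (f := F)) => //.
- exact: finite_faces.
- move=> i j iB jB FF; apply: pq_inj => //.
  by rewrite -(HF _ iB).2 FF (HF _ jB).2.
- move=> i iB; split; first exact: (HF _ iB).1.
  by apply: has_dim_segment; have [] := H _ iB.
Qed.

End Faces.

(** * Caps of the torus *)

Section Trigonometry.
Context {R : realType}.
Local Notation pi := (@pi R).
Implicit Types (x a c s t u phi alpha : R).

Lemma unit_circle_angle c s : c ^+ 2 + s ^+ 2 = 1 ->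
  exists alpha, [/\ - pi < alpha, alpha <= pi, cos alpha = c & sin alpha = s].
Proof.
move=> cs1.
have c2 : c ^+ 2 <= 1 by rewrite -cs1 lerDl sqr_ge0.
have c1 : -1 <= c <= 1 by apply/andP; split; nra.
have sE : sin (acos c) = `|s|.
  by rewrite sin_acos// -sqrtr_sqr; congr Num.sqrt; lra.
have [s0|s0] := leP 0 s.
  exists (acos c); split; [|exact: acos_lepi|by rewrite acosK// in_itv|].
    by rewrite (lt_le_trans _ (acos_ge0 c1))// oppr_lt0 pi_gt0.
  by rewrite sE ger0_norm.
exists (- acos c); split.
- by rewrite ltrN2 acos_ltpi//; apply/andP; split; nra.
- by rewrite (le_trans _ (pi_ge0 R))// oppr_le0 acos_ge0.
- by rewrite cosN acosK// in_itv.
- by rewrite sinN sE ltr0_norm// opprK.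
Qed.

Lemma polar_coordinates x y :
  exists a alpha, [/\ 0 <= a, - pi < alpha, alpha <= pi, x = a * cos alpha & y = a * sin alpha].
Proof.
have [xy0|xy0] := eqVneq (x ^+ 2 + y ^+ 2) 0.
  have [x0 y0] : x = 0 /\ y = 0.
    move/eqP: xy0; rewrite paddr_eq0 ?sqr_ge0// !expf_eq0/= => /andP[/eqP-> /eqP->].
    by [].
  exists 0, 0; rewrite !mul0r; split=> //; first by rewrite oppr_lt0 pi_gt0.
  exact: pi_ge0.
pose a := Num.sqrt (x ^+ 2 + y ^+ 2).
have a0 : 0 < a by rewrite sqrtr_gt0 lt_neqAle eq_sym xy0 addr_ge0// sqr_ge0.
have [|alpha [h1 h2 ca sa]] := @unit_circle_angle (x / a) (y / a).
  rewrite !expr_div_n -mulrDl sqr_sqrtr ?divff//.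
  by rewrite addr_ge0// sqr_ge0.
exists a, alpha; rewrite ca sa; split => //; first exact: ltW.
  by rewrite mulrC divfK// gt_eqF.
by rewrite mulrC divfK// gt_eqF.
Qed.

(** Two angles in the half-open interval from [- pi] to [pi] differ by less than [2 * pi], so at
    most one full turn, in either direction, brings the difference between [- pi] and [pi]. *)
Definition turn : set R := [set e | [\/ e = 0, e = 2 * pi | e = - (2 * pi)]].

Lemma cos_turn x e : turn e -> cos (x + e) = cos x.
Proof.
have pi2 : 2 * pi = pi *+ 2 by rewrite -[RHS]mulr_natl.
case=> ->; rewrite ?addr0// pi2 ?cosD2pi//.
by rewrite -[LHS]cosD2pi subrK.
Qed.

Lemma turnP phi alpha : - pi < phi <= pi -> - pi < alpha <= pi ->
  exists2 e, turn e & `|phi - alpha + e| <= pi.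
Proof.
move=> /andP[p1 p2] /andP[a1 a2].
have [h|h] := leP (phi - alpha) pi; last first.
  exists (- (2 * pi)); first by constructor 3.
  rewrite ler_norml; apply/andP; split; lra.
have [h'|h'] := leP (- pi) (phi - alpha).
  by exists 0; [constructor 1|rewrite addr0 ler_norml h h'].
exists (2 * pi); first by constructor 2.
rewrite ler_norml; apply/andP; split; lra.
Qed.

Lemma ltr_cos_norm x t : 0 <= t <= pi -> `|x| <= pi -> (cos t < cos x) = (`|x| < t).
Proof.
by move=> t0 xpi; rewrite -[cos x]cos_norm ltr_cos// in_itv/= ?normr_ge0.
Qed.

Lemma ler_cos_norm x t : 0 <= t <= pi -> `|x| <= pi -> (cos x < cos t) = (t < `|x|).
Proof.
by move=> t0 xpi; rewrite -[cos x]cos_norm ltr_cos// in_itv/= ?normr_ge0.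
Qed.

(** With [c = cos (u / 2)] the left-hand side is [2 c^2], and [0 <= c <= 1]. *)
Lemma cos_half_ge u : 0 <= u <= pi -> 1 + cos u <= 2 * cos (u / 2).
Proof.
move=> /andP[u0 upi].
have -> : cos u = cos (u / 2) ^+ 2 *+ 2 - 1.
  by rewrite -cos_mulr2n; congr cos; rewrite -mulr_natr; field.
have c0 : 0 <= cos (u / 2) by rewrite cos_ge0_pihalf//; apply/andP; split; have := pi_ge0 R; lra.
have := cos_le1 (u / 2); nra.
Qed.

(* The key point is [1 + cos u <= 2 * cos (u / 2)]: if the cap around [alpha] has
   [phi] and [phi'] on its boundary, then the arc of half its radius lies inside. *)
Lemma arc_radius phi phi' alpha :
  - pi < phi <= pi -> - pi < phi' <= pi -> - pi < alpha <= pi ->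
  exists u, [/\ 0 <= u, u <= pi,
    exists2 e, turn e & `|phi - alpha + e| <= u,
    exists2 e, turn e & `|phi' - alpha + e| <= u &
    forall x, `|x - alpha| < u / 2 ->
      cos (phi - alpha) + cos (phi' - alpha) < 2 * cos (x - alpha)].
Proof.
move=> hp hp' ha.
have [e te ep] := turnP hp ha; have [e' te' ep'] := turnP hp' ha.
pose u := Num.max `|phi - alpha + e| `|phi' - alpha + e'|.
have u0 : 0 <= u by rewrite le_max normr_ge0.
have upi : u <= pi by rewrite ge_max ep.
exists u; split=> //; [by exists e => //; rewrite le_max lexx| |].
  by exists e' => //; rewrite le_max lexx orbT.
move=> x xu.
have h : 2 * cos (u / 2) < 2 * cos (x - alpha).
  rewrite ltr_pM2l// ltr_cos_norm//; first by apply/andP; split; lra.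
  by apply: (le_trans (ltW xu)); lra.
apply: le_lt_trans h; apply: le_trans (cos_half_ge _); last by rewrite u0.
rewrite -(cos_turn (phi - alpha) te) -(cos_turn (phi' - alpha) te').
(* The farther of the two points contributes [cos u], the nearer one at most 1. *)
rewrite /u; case: (leP `|phi - alpha + e|) => _; rewrite cos_norm.
  by rewrite lerD2r cos_le1.
by rewrite addrC lerD2r cos_le1.
Qed.

End Trigonometry.

(** * Dyadic grids of angles and the covering of arcs *)

Section Grid.
Context {R : realType}.
Local Notation pi := (@pi R).
Implicit Types (x s t u phi alpha : R) (i a : nat).

Definition width i : R := 2 * pi / 2 ^+ i.

Definition grid i a : R := - pi + width i * a%:R.

Definition cell i a : set R := [set x | grid i a < x <= grid i a.+1].

(* 13 = 8 + 4 + 1 in [arc_cover], in units of [width i]: the radius u < 8 of an arc, the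
   distance u / 2 < 4 from its centre to the start of a half-arc, rounding to the grid. *)
Definition nbhd i a : set R :=
  [set x | exists2 e, turn e & `|x + e - grid i a| <= 13 * width i].

Lemma width_gt0 i : 0 < width i.
Proof. by rewrite divr_gt0 ?exprn_gt0// mulr_gt0// pi_gt0. Qed.

Lemma widthS i : width i = 2 * width i.+1.
Proof. by rewrite /width exprS; field; rewrite expf_eq0 pnatr_eq0 andbF. Qed.

Lemma width_expE i : width i * 2 ^+ i = 2 * pi.
Proof. by rewrite /width divfK// expf_neq0// pnatr_eq0. Qed.

Lemma gridS i a : grid i a.+1 = grid i a + width i.
Proof. by rewrite /grid -natr1; ring. Qed.

Lemma grid0 i : grid i 0 = - pi.
Proof. by rewrite /grid mulr0 addr0. Qed.

Lemma grid_max i : grid i (2 ^ i) = pi.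
Proof. by rewrite /grid natrX width_expE; ring. Qed.

Lemma grid_le i a b : (a <= b)%N -> grid i a <= grid i b.
Proof.
by move=> ab; rewrite /grid lerD2l ler_pM2l ?width_gt0// ler_nat.
Qed.

Lemma grid_lt_inj i a b : grid i a < grid i b -> (a < b)%N.
Proof. by apply: contraTltn => /(grid_le i); rewrite leNgt. Qed.

Lemma cell_exists i s : - pi < s <= pi -> exists2 a, (a < 2 ^ i)%N & cell i a s.
Proof.
move=> /andP[s1 s2].
have ex : exists n, s <= grid i n by exists (2 ^ i)%N; rewrite grid_max.
case: (ex_minnP ex) => -[|n] sn min; first by move: sn; rewrite grid0 leNgt s1.
exists n; first by apply: min; rewrite grid_max.
by rewrite /cell/= sn andbT ltNge; apply/negP => /min; rewrite ltnn.
Qed.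

Lemma cell_uniq i a b x : cell i a x -> cell i b x -> a = b.
Proof.
move=> /andP[a1 a2] /andP[b1 b2]; apply/eqP; rewrite eqn_leq -ltnS -(ltnS b).
by rewrite !(@grid_lt_inj i)// ?(lt_le_trans a1)// (lt_le_trans b1).
Qed.

Lemma cell_sub i a : (a < 2 ^ i)%N -> cell i a `<=` [set x | - pi < x <= pi].
Proof.
move=> ai x /andP[h1 h2]; apply/andP; split.
  by apply: le_lt_trans h1; rewrite -(grid0 i) grid_le.
by apply: le_trans h2 _; rewrite -[leRHS](grid_max i) grid_le.
Qed.

(** The scale is the coarsest one with [4 * width i <= u], so that [u < 8 * width i] by minimality,
    while a half-arc of length [u / 2] still spans two cell widths and contains a whole cell. If
    even scale [n] is too coarse, both points are close to the cell of [alpha], which is the second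
    alternative. *)
Lemma arc_cover n phi phi' alpha :
  - pi < phi <= pi -> - pi < phi' <= pi -> - pi < alpha <= pi ->
  (exists i a, [/\ (i <= n)%N, (a < 2 ^ i)%N, nbhd i a phi, nbhd i a phi' &
     forall x, cell i a x ->
       cos (phi - alpha) + cos (phi' - alpha) < 2 * cos (x - alpha)]) \/
  (exists a, [/\ (a < 2 ^ n)%N, nbhd n a phi & nbhd n a phi']).
Proof.
move=> hp hp' ha; have [u [u0 upi [e te eu] [e' te' eu'] Hu]] := arc_radius hp hp' ha.
have [nu|nu] := leP (4 * width n) u; last first.
  right; have [a an /andP[a1 a2]] := cell_exists n ha.
  exists a; split=> //; rewrite gridS in a2.
    exists e => //; move: eu; rewrite !ler_norml => /andP[? ?].
    by apply/andP; split; lra.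
  exists e' => //; move: eu'; rewrite !ler_norml => /andP[? ?].
  by apply/andP; split; lra.
left.
have ex : exists i, 4 * width i <= u by exists n.
case: (ex_minnP ex) => -[|i] iu min.
  by move: iu; rewrite /width expr0 divr1; have := pi_gt0 R; lra.
have iu' : u < 4 * width i by rewrite ltNge; apply/negP => /min; rewrite ltnn.
rewrite widthS in iu'; set w := width i.+1 in iu iu'.
have w0 : 0 < w := width_gt0 _.
case/andP: ha => ha1 ha2.
(* Cells do not wrap around the cut at [pi], so the half-arc is taken on the side of [alpha] that
   points towards 0. *)
have [s [s1 s2 s3 s4]] : exists s, [/\ - pi < s, s + u / 2 <= pi, `|s - alpha| <= u / 2 &
    forall x, s < x -> x < s + u / 2 -> `|x - alpha| < u / 2].
  have [a0|a0] := leP 0 alpha.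
    exists (alpha - u / 2); split=> [| | |x x1 x2].
    - lra.
    - lra.
    - by rewrite ler_norml; apply/andP; split; lra.
    - by rewrite ltr_norml; apply/andP; split; lra.
  exists alpha; split=> [| | |x x1 x2].
  - lra.
  - lra.
  - by rewrite ler_norml; apply/andP; split; lra.
  - by rewrite ltr_norml; apply/andP; split; lra.
have [|a ai] := @cell_exists i.+1 s; first by apply/andP; split; lra.
rewrite /cell/= gridS -/w => /andP[g1 g2].
have gS : grid i.+1 a.+1 = grid i.+1 a + w := gridS _ _.
have gSS : grid i.+1 a.+2 = grid i.+1 a + w + w by rewrite !gridS.
(* The cell [a] of [s] may stick out of the half-arc on the left; the next one ends before
   [s + 2 * w <= s + u / 2]. *)
exists i.+1, a.+1; split.
- exact: min.
- by apply: (@grid_lt_inj i.+1); rewrite grid_max; lra.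
- exists e => //; rewrite gS -/w; move: eu s3; rewrite !ler_norml => /andP[? ?] /andP[? ?].
  by apply/andP; split; lra.
- exists e' => //; rewrite gS -/w; move: eu' s3; rewrite !ler_norml => /andP[? ?] /andP[? ?].
  by apply/andP; split; lra.
- by move=> x /andP[]; rewrite gS gSS => x1 x2; apply: Hu; apply: s4; lra.
Qed.

End Grid.

(** * Linear functionals on the torus and their caps *)

Section TorusGeometry.
Context {R : realType}.
Local Notation E4 := ('rV[R]_4).
Local Notation pi := (@pi R).

Lemma angle_squareE (t : R * R) :
  angle_square t <-> (- pi < t.1 <= pi) /\ (- pi < t.2 <= pi).
Proof. by rewrite /angle_square /= !in_itv/=. Qed.

Lemma dot_clifford_map (u : E4) (t : R * R) : dot u (clifford_map t) =
  u 0 0 * cos t.1 + u 0 1 * sin t.1 + u 0 (2%:R) * cos t.2 + u 0 (3%:R) * sin t.2.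
Proof.
rewrite dot_sumE !big_ord_recl big_ord0 /clifford_map !mxE/= addr0 !addrA.
by congr (_ * _ + _ * _ + _ * _ + _ * _); congr (u _ _); apply: val_inj.
Qed.

Lemma clifford_torus_sphere (x : E4) : clifford_torus x -> dot x x = 2.
Proof.
move=> [t _ <-]; rewrite dot_clifford_map /clifford_map !mxE /=.
have := cos2Dsin2 t.1; have := cos2Dsin2 t.2; lra.
Qed.

(** Polar form of the two planar components of [u]. The last clause turns [u != 0] into a positive
    amplitude. *)
Lemma dot_clifford_polar (u : E4) : exists a b alpha beta : R,
  [/\ 0 <= a, 0 <= b, - pi < alpha <= pi, - pi < beta <= pi &
    (forall t, dot u (clifford_map t) = a * cos (t.1 - alpha) + b * cos (t.2 - beta)) /\
    (a = 0 -> b = 0 -> u = 0)].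
Proof.
have [a [al [a0 h1 h2 ea ea']]] := polar_coordinates (u 0 0) (u 0 1).
have [b [be [b0 k1 k2 eb eb']]] := polar_coordinates (u 0 (2%:R)) (u 0 (3%:R)).
exists a, b, al, be; split=> //; [exact/andP|exact/andP|split].
  by move=> t; rewrite dot_clifford_map ea ea' eb eb' !cosB; ring.
move=> z1 z2; apply/rowP => i; rewrite mxE.
rewrite z1 !mul0r in ea ea'; rewrite z2 !mul0r in eb eb'.
case: i => -[|[|[|[|//]]]] hi; [rewrite -ea|rewrite -ea'|rewrite -eb|rewrite -eb'];
  by congr (u _ _); apply: val_inj.
Qed.

Lemma dot_clifford_polar_ex (a b alpha beta : R) : exists u : E4,
  forall t, dot u (clifford_map t) = a * cos (t.1 - alpha) + b * cos (t.2 - beta).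
Proof.
exists (\row_(i < 4) [:: a * cos alpha; a * sin alpha; b * cos beta; b * sin beta]`_i).
by move=> t; rewrite dot_clifford_map !mxE /= !cosB; ring.
Qed.

Lemma angle_inj (x y : R) : - pi < x <= pi -> - pi < y <= pi ->
  cos x = cos y -> sin x = sin y -> x = y.
Proof.
move=> hx hy exy sxy; have [e te xy] := turnP hx hy.
have : cos (x - y + e) = cos 0.
  by rewrite cos_turn// cosB exy sxy cos0 -!expr2 cos2Dsin2.
rewrite -cos_norm => /cos_inj; rewrite !in_itv/= !lexx normr_ge0 xy pi_ge0.
move=> /(_ isT isT)/eqP; rewrite normr_eq0 => /eqP.
by case/andP: hx => ? ?; case/andP: hy => ? ?; case: te => ->; lra.
Qed.

Lemma clifford_map_inj (t t' : R * R) : angle_square t -> angle_square t' ->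
  clifford_map t = clifford_map t' -> t = t'.
Proof.
move=> /angle_squareE[t1 t2] /angle_squareE[t1' t2'] /rowP e.
rewrite [t]surjective_pairing [t']surjective_pairing; congr pair; apply: angle_inj => //.
- by have := e 0; rewrite !mxE.
- by have := e 1; rewrite !mxE.
- by have := e 2%:R; rewrite !mxE.
- by have := e 3%:R; rewrite !mxE.
Qed.

(** A point of [X] in the product of the two cells provided by [arc_cover] would have a value of [u]
    above the supporting level [c]. *)
Lemma edge_cover (X : set E4) n (u : E4) c (t t' : R * R) :
  X `<=` [set x | dot u x <= c] -> u != 0 ->
  angle_square t -> angle_square t' ->
  dot u (clifford_map t) = c -> dot u (clifford_map t') = c ->
  [\/ (exists i j a b, [/\ ((i <= n) && (j <= n))%N, ((a < 2 ^ i) && (b < 2 ^ j))%N,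
        (nbhd i a `*` nbhd j b) t, (nbhd i a `*` nbhd j b) t' &
        forall s, X (clifford_map s) -> ~ (cell i a `*` cell j b) s]),
      (exists a, [/\ (a < 2 ^ n)%N, nbhd n a t.1 & nbhd n a t'.1]) |
      (exists b, [/\ (b < 2 ^ n)%N, nbhd n b t.2 & nbhd n b t'.2])].
Proof.
move=> Xu u0 /angle_squareE[t1 t2] /angle_squareE[t1' t2'] ut ut'.
have [a [b [al [be [a0 b0 ha hb [uE u_eq0]]]]]] := dot_clifford_polar u.
have [[i [k [hi hk pk pk' H1]]]|] := arc_cover n t1 t1' ha; last first.
  by move=> h; constructor 2.
have [[j [l [hj hl pl pl' H2]]]|] := arc_cover n t2 t2' hb; last first.
  by move=> h; constructor 3.
constructor 1; exists i, j, k, l; split=> //; [exact/andP|exact/andP|] => s Xs [s1 s2].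
have := Xu _ Xs; move: ut ut'; rewrite /= !uE => ut ut' us.
have := H1 _ s1; have := H2 _ s2.
set A := cos _ + cos _; set B := cos _ + cos _ => h1 h2.
(* The sum of the two boundary equations; weighted by [a] and [b], the inequalities [h1] and [h2]
   contradict [us] as soon as one weight is positive. *)
have AB : a * B + b * A = 2 * c by rewrite /A /B; lra.
have [az|an] := eqVneq a 0.
  have [bz|bn] := eqVneq b 0; first by move/eqP: u0; apply; apply: u_eq0.
  have bp : 0 < b by rewrite lt_neqAle eq_sym bn.
  by rewrite az in AB us; nra.
have ap : 0 < a by rewrite lt_neqAle eq_sym an.
nra.
Qed.

(** Doubling an angle at least doubles [1 - cos]: [1 - cos (2 s) = 2 (1 - (cos s)^2)], and
    [(cos s)^2 <= cos s]. The bounds on [al - 2 * s] and [al + 2 * s] keep the arc off the cut, so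
    that a point far from [al] in the interval is also far on the circle. *)
Lemma far_cos (phi al s : R) : - pi < phi <= pi -> - pi < al - 2 * s -> al + 2 * s <= pi ->
  0 < s <= pi / 4 -> 2 * s < `|phi - al| -> 2 * (1 - cos s) < 1 - cos (phi - al).
Proof.
move=> hphi al1 al2 /andP[s0 s1] far.
have hal : - pi < al <= pi by apply/andP; split; lra.
have [e te ple] := turnP hphi hal.
have e_far : 2 * s < `|phi - al + e|.
  move: far; case/andP: hphi => ? ?.
  case: te ple => ->; first by rewrite addr0.
    rewrite ler_norml => /andP[? ?] _.
    by rewrite ltr_normr; apply/orP; left; lra.
  rewrite ler_norml => /andP[? ?] _.
  by rewrite ltr_normr; apply/orP; right; lra.
have : cos (phi - al + e) < cos (2 * s).
  by rewrite ler_cos_norm//; apply/andP; split; lra.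
rewrite cos_turn// mulr_natl cos_mulr2n.
have c0 : 0 <= cos s by rewrite cos_ge0_pihalf//; apply/andP; split; lra.
have c1 := cos_le1 s.
have : cos s ^+ 2 <= cos s by rewrite expr2 ler_piMl.
rewrite -mulr_natl; lra.
Qed.

Lemma close_pair_supporting (X : set E4) (t t' : R * R) :
  let m1 := (t.1 + t'.1) / 2 in let m2 := (t.2 + t'.2) / 2 in
  let d1 := t'.1 - t.1 in let d2 := t'.2 - t.2 in
  X `<=` clifford_torus ->
  0 < d1 <= pi / 2 -> - pi < m1 - d1 -> m1 + d1 <= pi ->
  0 < d2 <= pi / 2 -> - pi < m2 - d2 -> m2 + d2 <= pi ->
  (forall s, angle_square s -> X (clifford_map s) ->
     `|s.1 - m1| <= d1 -> `|s.2 - m2| <= d2 -> s = t \/ s = t') ->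
  exists u c, [/\ X `<=` [set x | dot u x <= c],
    dot u (clifford_map t) = c, dot u (clifford_map t') = c &
    forall x, X x -> dot u x = c -> x = clifford_map t \/ x = clifford_map t'].
Proof.
move=> m1 m2 d1 d2 XT /andP[d1p d1pi] m1l m1r /andP[d2p d2pi] m2l m2r HX.
have cos_lt1 (d : R) : 0 < d <= pi / 2 -> 0 < 1 - cos (d / 2).
  move=> /andP[? ?]; have := pi_gt0 R => ?; rewrite subr_gt0 -[ltRHS]cos0 ltr_cos; first lra.
  - by rewrite in_itv/=; apply/andP; split; lra.
  - by rewrite in_itv/=; apply/andP; split; lra.
(* The cap [(1 - cos x) / A + (1 - cos y) / B <= 2] has both points on its boundary and
   is contained in the box of half-widths [d1, d2], as [2 * (1 - cos (d1 / 2)) <= 1 - cos d1]. *)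
pose A := 1 - cos (d1 / 2); pose B := 1 - cos (d2 / 2).
have A0 : 0 < A by apply: cos_lt1; rewrite d1p.
have B0 : 0 < B by apply: cos_lt1; rewrite d2p.
have [u uE] := dot_clifford_polar_ex A^-1 B^-1 m1 m2.
pose c := A^-1 + B^-1 - 2.
have uE' s : dot u (clifford_map s) =
    c + 2 - (1 - cos (s.1 - m1)) / A - (1 - cos (s.2 - m2)) / B.
  by rewrite uE /c; field; rewrite !gt_eqF.
have ut : dot u (clifford_map t) = c.
  rewrite uE'; have -> : t.1 - m1 = - (d1 / 2) by rewrite /m1 /d1; field.
  have -> : t.2 - m2 = - (d2 / 2) by rewrite /m2 /d2; field.
  by rewrite !cosN divff ?gt_eqF// divff ?gt_eqF//; ring.
have ut' : dot u (clifford_map t') = c.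
  rewrite uE'; have -> : t'.1 - m1 = d1 / 2 by rewrite /m1 /d1; field.
  have -> : t'.2 - m2 = d2 / 2 by rewrite /m2 /d2; field.
  by rewrite divff ?gt_eqF// divff ?gt_eqF//; ring.
have Hlt x : X x -> [\/ x = clifford_map t, x = clifford_map t' | dot u x < c].
  move=> Xx; have [s sq sx] := XT _ Xx; rewrite -sx in Xx *.
  have [s1 s2] := (angle_squareE s).1 sq.
  have pos (d y : R) : 0 < d -> 0 <= (1 - cos y) / d.
    by move=> dp; rewrite divr_ge0 ?subr_ge0 ?cos_le1// ltW.
  (* Outside the box the term of one coordinate alone exceeds 2, by [far_cos] with [s = d1 / 2] or
     [s = d2 / 2], and the other term is nonnegative. *)
  have [h1|h1] := leP `|s.1 - m1| d1; last first.
    constructor 3; have : 2 < (1 - cos (s.1 - m1)) / A.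
      rewrite ltr_pdivlMr//; apply: far_cos => //; lra.
    by rewrite uE'; have := pos B (s.2 - m2) B0; lra.
  have [h2|h2] := leP `|s.2 - m2| d2; last first.
    constructor 3; have : 2 < (1 - cos (s.2 - m2)) / B.
      rewrite ltr_pdivlMr//; apply: far_cos => //; lra.
    by rewrite uE'; have := pos A (s.1 - m1) A0; lra.
  by have [->|->] := HX s sq Xx h1 h2; [constructor 1|constructor 2].
exists u, c; split=> //.
  by move=> x /Hlt[->|->|/ltW]; rewrite /= ?ut ?ut'.
by move=> x /Hlt[->|->|xc] e; [left|right|move: xc; rewrite e ltxx].
Qed.

End TorusGeometry.

(** * Measurable regions of the torus *)

Section TorusBorel.
Context {R : realType}.
Local Notation E4 := ('rV[R]_4).
Local Notation pi := (@pi R).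
Local Notation borel := <<s (@open E4) >>.

Lemma clifford_map_continuous : continuous (@clifford_map R).
Proof.
have -> : @clifford_map R = fun t => cos t.1 *: delta_mx 0 0 + sin t.1 *: delta_mx 0 1
    + cos t.2 *: delta_mx 0 (2%:R) + sin t.2 *: delta_mx 0 (3%:R).
  apply/funext => t; apply/rowP => i; rewrite !mxE /=.
  by case: i => -[|[|[|[|//]]]] hi; rewrite /= !(mulr1, mulr0, addr0, add0r).
move=> t; apply: cvgD; last first.
  by apply: cvgZr_tmp; apply: cvg_comp; [exact: cvg_snd|exact: continuous_sin].
apply: cvgD; last first.
  by apply: cvgZr_tmp; apply: cvg_comp; [exact: cvg_snd|exact: continuous_cos].
apply: cvgD; apply: cvgZr_tmp; apply: cvg_comp; [exact: cvg_fst| |exact: cvg_fst|].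
  exact: continuous_cos.
exact: continuous_sin.
Qed.

Lemma compact_image_borel (S : set (R * R)) : compact S -> borel (clifford_map @` S).
Proof.
move=> cS; have : closed (clifford_map @` S).
  apply: compact_closed; first exact: norm_hausdorff.
  by apply: continuous_compact => //; apply: continuous_subspaceT; exact: clifford_map_continuous.
move=> /closed_openC oS; rewrite -[X in borel X]setCK -setTD.
have [_ bC _] := smallest_sigma_algebra setT (@open E4).
by apply: bC; exact: sub_gen_smallest.
Qed.

Lemma borel_setC_torus (S : set (R * R)) :
  borel (clifford_map @` angle_square) ->
  borel (clifford_map @` (S `&` angle_square)) ->
  borel (clifford_map @` (~` S `&` angle_square)).
Proof.
move=> bT bS.
have -> : clifford_map @` (~` S `&` angle_square) =
    clifford_map @` angle_square `\` clifford_map @` (S `&` angle_square).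
  apply/seteqP; split=> [_ [t [nSt sqt] <-]|x [[t sqt <-] nx]].
    split; first by exists t.
    by move=> [s [Ss sqs]] /clifford_map_inj => /(_ sqs sqt) st; apply: nSt; rewrite -st.
  by exists t => //; split=> // St; apply: nx; exists t.
rewrite setDE -[X in borel X]setCK setCI setCK.
have [b0 bC bU] := smallest_sigma_algebra setT (@open E4).
rewrite -setTD; apply: (bC).
rewrite -bigcup2E; apply: (bU) => -[|[|n]] //=.
by rewrite -setTD; exact: bC.
Qed.

(** The strips are countable unions of compact rectangles, whose images are compact and hence
    closed. *)
Lemma borel_image_strip (P : nat -> set R) (A : set R) :
  (forall n, compact (P n)) -> A `&` `]- pi, pi] = \bigcup_n P n ->
  borel (clifford_map @` ((A `*` setT) `&` angle_square)) /\
  borel (clifford_map @` ((setT `*` A) `&` angle_square)).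
Proof.
move=> cP AP.
have [b0 bC bU] := smallest_sigma_algebra setT (@open E4).
pose Q n : set R := `[- pi + n.+1%:R^-1, pi]%classic.
have QE : `]- pi, pi]%classic = \bigcup_n Q n.
  apply/seteqP; split=> x /=; rewrite in_itv/=.
    move=> /andP[x1 x2]; have xp : 0 < x + pi by lra.
    have [n _ /= nx] := near_infty_natSinv_lt (PosNum xp).
    exists n => //=; rewrite /Q/= in_itv/= x2 andbT.
    rewrite -lerBrDl opprK; exact/ltW/(nx n (leqnn n)).
  move=> [n _]; rewrite /Q/= in_itv/= => /andP[x1 ->]; rewrite andbT.
  by apply: lt_le_trans x1; rewrite ltrDl invr_gt0 ltr0n.
have cQ n : compact (Q n) by exact: segment_compact.
split.
  have -> : (A `*` setT) `&` angle_square = \bigcup_n (\bigcup_m (P n `*` Q m)).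
    apply/seteqP; split=> [t [[At _] [t1 t2]]|t [n _ [m _ [t1 t2]]]].
      have : (A `&` `]- pi, pi]) t.1 by [].
      rewrite AP => -[n _ Pn]; move: t2; rewrite QE => -[m _ Qm].
      by exists n => //; exists m.
    have : (\bigcup_n P n) t.1 by exists n.
    rewrite -AP => -[? ?]; split; split=> //.
    by rewrite QE; exists m.
  rewrite image_bigcup; apply: (bU) => n; rewrite image_bigcup; apply: (bU) => m.
  by apply: compact_image_borel; apply: compact_setX.
have -> : (setT `*` A) `&` angle_square = \bigcup_n (\bigcup_m (Q m `*` P n)).
  apply/seteqP; split=> [t [[_ At] [t1 t2]]|t [n _ [m _ [t1 t2]]]].
    have : (A `&` `]- pi, pi]) t.2 by [].
    rewrite AP => -[n _ Pn]; move: t1; rewrite QE => -[m _ Qm].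
    by exists n => //; exists m.
  have : (\bigcup_n P n) t.2 by exists n.
  rewrite -AP => -[? ?]; split; split=> //.
  by rewrite QE; exists m.
rewrite image_bigcup; apply: (bU) => n; rewrite image_bigcup; apply: (bU) => m.
by apply: compact_image_borel; apply: compact_setX.
Qed.

Lemma borel_image_halfline (x : R) :
  exists P : nat -> set R, (forall n, compact (P n)) /\
    `[x, +oo[%classic `&` `]- pi, pi] = \bigcup_n P n.
Proof.
exists (fun n => `[Num.max x (- pi + n.+1%:R^-1), pi]%classic); split.
  by move=> n; exact: segment_compact.
apply/seteqP; split=> y /=; rewrite !in_itv/= ?andbT.
  move=> [xy /andP[y1 y2]]; have xp : 0 < y + pi by lra.
  have [n _ /= nx] := near_infty_natSinv_lt (PosNum xp).
  exists n => //=; rewrite in_itv/= y2 andbT ge_max xy/=.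
  rewrite -lerBrDl opprK; exact/ltW/(nx n (leqnn n)).
move=> [n _] /=; rewrite in_itv/= ge_max => /andP[/andP[xy y1] ->]; rewrite andbT.
by split=> //; apply: lt_le_trans y1; rewrite ltrDl invr_gt0 ltr0n.
Qed.

(** The sets whose trace on the square has a Borel image form a sigma-algebra: complements pass
    through the map because it is injective on the square. Half-lines generate the Borel sets of
    each factor, and their strips are covered by [borel_image_strip]. *)
Lemma borel_image (S : set (R * R)) : measurable S ->
  borel (clifford_map @` (S `&` angle_square)).
Proof.
have [b0 bC bU] := smallest_sigma_algebra setT (@open E4).
have half x := let: ex_intro P (conj cP PE) := borel_image_halfline x in
  borel_image_strip cP PE.
have bT : borel (clifford_map @` angle_square).
  have [h _] := half (- pi).
  suff <- : (`[(- pi), +oo[%classic `*` setT) `&` angle_square = angle_square by [].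
  by apply/seteqP; split=> [t []//|t /[dup] ? -[/=]]; rewrite !in_itv/= ?andbT => /andP[/ltW].
have alg (f : set R -> set (R * R)) :
    (forall A, f (~` A) = ~` (f A)) -> f set0 = set0 ->
    (forall F : nat -> set R, f (\bigcup_n F n) = \bigcup_n f (F n)) ->
    (forall x, borel (clifford_map @` (f `[x, +oo[%classic `&` angle_square))) ->
    forall A, measurable A -> borel (clifford_map @` (f A `&` angle_square)).
  move=> fC f0 fU fh A mA.
  have : (@ocitv R).-sigma.-measurable A by exact: mA.
  rewrite measurable_realfun.RGenCInfty.measurableE.
  suff h : smallest (sigma_algebra setT) (@measurable_realfun.RGenCInfty.G R) `<=`
      [set A | borel (clifford_map @` (f A `&` angle_square))] by exact: h.
  apply: smallest_sub.
    split=> [|B hB|F hF] /=.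
    - by rewrite f0 set0I image_set0.
    - by rewrite setTD fC; apply: borel_setC_torus.
    - by rewrite fU setI_bigcupl image_bigcup; apply: (bU).
  by move=> _ [x ->] /=.
have h1 (A : set R) : measurable A -> borel (clifford_map @` ((A `*` setT) `&` angle_square)).
  apply: (alg (fun A => A `*` setT)).
  - by move=> B; apply/seteqP; split=> [t [nB _] [Bt _]|t nB]; [exact: nB|split=> // Bt; exact: nB].
  - by rewrite set0X.
  - by move=> F; apply/seteqP; split=> [t [[n _ ?] _]|t [n _ [? _]]]; [exists n|split=> //; exists n].
  - by move=> x; have [] := half x.
have h2 (A : set R) : measurable A -> borel (clifford_map @` ((setT `*` A) `&` angle_square)).
  apply: (alg (fun A => setT `*` A)).
  - by move=> B; apply/seteqP; split=> [t [_ nB] [_ Bt]|t nB]; [exact: nB|split=> // Bt; exact: nB].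
  - by rewrite setX0.
  - by move=> F; apply/seteqP; split=> [t [_ [n _ ?]]|t [n _ [_ ?]]]; [exists n|split=> //; exists n].
  - by move=> x; have [] := half x.
rewrite measurable_prod_measurableType.
set G := [set A `*` B | A in _ & B in _].
suff h : smallest (sigma_algebra setT) G `<=`
    [set S | borel (clifford_map @` (S `&` angle_square))] by exact: h.
apply: smallest_sub.
  split=> [|B hB|F hF] /=.
  - by rewrite set0I image_set0.
  - by rewrite setTD; apply: borel_setC_torus.
  - by rewrite setI_bigcupl image_bigcup; apply: (bU).
move=> _ [A mA [B mB <-]] /=.
(* A rectangle is expressed through complements and a union, the operations that the family of good
   sets is closed under. *)
have -> : A `*` B `&` angle_square = ~` (~` (A `*` setT) `|` ~` (setT `*` B)) `&` angle_square.
  rewrite setCU !setCK; congr (_ `&` _).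
  by apply/seteqP; split=> [t []|t [[? ?] [? ?]]].
apply: borel_setC_torus => //; rewrite setIUl image_setU -bigcup2E.
apply: (bU) => -[|[|n]] //=; apply: borel_setC_torus => //; [exact: h1|exact: h2].
Qed.

End TorusBorel.

(** * Flat area of regions in angle coordinates *)

Section Area.
Context {R : realType}.
Local Notation E4 := ('rV[R]_4).
Local Notation pi := (@pi R).
Local Notation leb := (@lebesgue_measure R).
Implicit Types (S T : set (R * R)) (A B : set R).

Definition circle : set R := `]- pi, pi].

Definition area S : R := fine ((leb \x leb) S)%E.

Definition torus_measurable S := measurable S /\ S `<=` angle_square.

Lemma leb_circle : leb circle = (2 * pi)%:E.
Proof.
rewrite /circle lebesgue_measure_itv /= lte_fin ifT; last by have := pi_gt0 R; lra.
by congr EFin; rewrite opprK; ring.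
Qed.

Lemma angle_squareX : @angle_square R = circle `*` circle.
Proof. by []. Qed.

Lemma measurable_circle : measurable circle.
Proof. exact: measurable_itv. Qed.

Lemma torus_measurable_square : torus_measurable angle_square.
Proof.
by split=> //; rewrite angle_squareX; apply: measurableX; exact: measurable_circle.
Qed.

Lemma torus_measurableX A B : measurable A -> measurable B ->
  A `<=` circle -> B `<=` circle -> torus_measurable (A `*` B).
Proof.
move=> mA mB AC BC; split; first exact: measurableX.
by rewrite angle_squareX => t [At Bt]; split; [exact: AC|exact: BC].
Qed.

Lemma torus_measurableD S T : torus_measurable S -> torus_measurable T ->
  torus_measurable (S `\` T).
Proof.
move=> [mS Ssq] [mT _]; split; first exact: measurableD.
by move=> t [/Ssq].
Qed.

Lemma torus_measurable0 : torus_measurable set0.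
Proof. by split. Qed.

Lemma leb2_square : (leb \x leb)%E (@angle_square R) = ((2 * pi) ^+ 2)%:E.
Proof.
rewrite angle_squareX product_measure1E; [|exact: measurable_circle..].
by transitivity (leb circle * leb circle)%E => //; rewrite leb_circle -EFinM expr2.
Qed.

Lemma leb2_fin S : torus_measurable S -> (leb \x leb)%E S \is a fin_num.
Proof.
move=> [mS Ssq]; rewrite ge0_fin_numE; last exact: measure_ge0.
have [mT _] := torus_measurable_square.
apply: (@le_lt_trans _ _ ((leb \x leb)%E (@angle_square R))).
  by apply: le_measure; rewrite ?inE.
by rewrite leb2_square ltry.
Qed.

Lemma area_ge0 S : 0 <= area S.
Proof. by rewrite fine_ge0. Qed.

Lemma area_set0 : area set0 = 0.
Proof. by rewrite /area measure0. Qed.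

Lemma area_square : area angle_square = (2 * pi) ^+ 2.
Proof. by rewrite /area leb2_square. Qed.

Lemma area_le S T : torus_measurable S -> torus_measurable T -> S `<=` T ->
  area S <= area T.
Proof.
move=> mS mT ST; rewrite fine_le ?leb2_fin//.
by apply: le_measure; rewrite ?inE//; [exact: mS.1|exact: mT.1].
Qed.

Lemma areaX_le A B (a b : R) : measurable A -> measurable B ->
  (leb A <= a%:E)%E -> (leb B <= b%:E)%E -> area (A `*` B) <= a * b.
Proof.
move=> mA mB Aa Bb.
have : ((leb \x leb) (A `*` B) <= (a * b)%:E)%E.
  rewrite product_measure1E// EFinM.
  by apply: lee_pmul => //; exact: measure_ge0.
have ab0 : 0 <= a * b.
  by rewrite mulr_ge0// -lee_fin; [apply: le_trans Aa|apply: le_trans Bb].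
rewrite /area; move: ((_ \x _)%E _) => [r||] //=.
Qed.

Lemma areaX A B (a b : R) : measurable A -> measurable B ->
  leb A = a%:E -> leb B = b%:E -> area (A `*` B) = a * b.
Proof.
by move=> mA mB Aa Bb; rewrite /area product_measure1E//= Aa Bb -EFinM.
Qed.

Lemma borel_in_torus_image S : torus_measurable S -> borel_in_torus (clifford_map @` S).
Proof.
move=> [mS Ssq]; split; last by move=> _ [t St <-]; exists t => //; exact: Ssq.
by rewrite -(setIidl Ssq); exact: borel_image.
Qed.

Lemma mes2_image S : torus_measurable S -> fine (mes2 (clifford_map @` S)) = area S.
Proof.
move=> [mS Ssq]; rewrite /mes2 /area; congr (fine (_ _)).
apply/seteqP; split=> [t [sqt [s Ss]]|t St].
  by move/clifford_map_inj => /(_ (Ssq _ Ss) sqt) <-.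
by split; [exact: Ssq|exists t].
Qed.

Lemma image_disjoint S T : S `<=` angle_square -> T `<=` angle_square ->
  S `&` T = set0 -> clifford_map @` S `&` clifford_map @` T = set0.
Proof.
move=> Ssq Tsq ST; apply/seteqP; split=> // _ [[s Ss <-] [t Tt]].
move/clifford_map_inj => /(_ (Tsq _ Tt) (Ssq _ Ss)) ts.
suff : (S `&` T) s by rewrite ST.
by split=> //; rewrite -ts.
Qed.

Lemma measurable_cell i a : measurable (cell i a : set R).
Proof.
have -> : cell i a = `]grid i a, grid i a.+1]%classic :> set R; last exact: measurable_itv.
by apply/seteqP; split=> x; rewrite /cell/= in_itv.
Qed.

Lemma leb_cell i a : leb (cell i a) = (width i)%:E.
Proof.
have -> : cell i a = `]grid i a, grid i a.+1]%classic :> set R.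
  by apply/seteqP; split=> x; rewrite /cell/= in_itv.
rewrite lebesgue_measure_itv /= lte_fin gridS ltrDl width_gt0.
by congr EFin; rewrite addrAC subrr add0r.
Qed.

Lemma nbhdE i a : nbhd i a = \bigcup_(e in turn)
  `[grid i a - 13 * width i - e, grid i a + 13 * width i - e]%classic :> set R.
Proof.
apply/seteqP; split=> x.
  move=> [e te]; rewrite ler_norml => /andP[h1 h2]; exists e => //=; rewrite in_itv/=.
  by apply/andP; split; lra.
move=> [e te] /=; rewrite in_itv/= => /andP[h1 h2]; exists e => //.
by rewrite ler_norml; apply/andP; split; lra.
Qed.

Lemma turnE : @turn R = [set 0] `|` [set 2 * pi] `|` [set - (2 * pi)].
Proof.
apply/seteqP; split=> x; first by case; [left; left|left; right|right].
by case=> [[]|]; [constructor 1|constructor 2|constructor 3].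
Qed.

Lemma measurable_nbhd i a : measurable (nbhd i a : set R).
Proof.
rewrite nbhdE turnE !bigcup_setU !bigcup_set1.
by apply: measurableU; first apply: measurableU; exact: measurable_itv.
Qed.

(** One interval of length [26 * width i] for each of the three turns, and [78 = 3 * 26]. *)
Lemma leb_nbhd i a : (leb (nbhd i a `&` circle) <= (78 * width i)%:E)%E.
Proof.
pose I e : set R := `[grid i a - 13 * width i - e, grid i a + 13 * width i - e]%classic.
have mI e : measurable (I e) by exact: measurable_itv.
have w0 : 0 < width i :> R := width_gt0 i.
have lI e : leb (I e) = (26 * width i)%:E.
  rewrite /I lebesgue_measure_itv /= lte_fin ifT; last by lra.
  by congr EFin; ring.
have -> : 78 * width i = 26 * width i + 26 * width i + 26 * width i :> R by ring.
apply: (@le_trans _ _ (leb (I 0 `|` I (2 * pi) `|` I (- (2 * pi))))).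
  apply: le_measure; rewrite ?inE.
  - by apply: measurableI; [exact: measurable_nbhd|exact: measurable_circle].
  - exact: (measurableU _ _ (measurableU _ _ (mI _) (mI _)) (mI _)).
  - by rewrite nbhdE turnE !bigcup_setU !bigcup_set1 => x [].
rewrite 2!EFinD.
have h1 := measureU2 leb (measurableU _ _ (mI 0) (mI (2 * pi))) (mI (- (2 * pi))).
have h2 := measureU2 leb (mI 0) (mI (2 * pi)).
have lI2 e : (leb (I e) <= (26 * width i)%:E)%E by rewrite lI.
apply: (le_trans h1); apply: leeD; last exact: lI2.
by apply: (le_trans h2); apply: leeD; exact: lI2.
Qed.

End Area.

(** * Counts of a Poisson process *)

Section PoissonSeries.
Context {R : realType}.
Implicit Types (mu : R) (k : nat).

(** Since [0 ^+ 0 = 1], the value [mu = 0] gives the Dirac mass at 0, in agreement with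
    [poisson_prob]. *)
Definition pois mu k : R := expR (- mu) * mu ^+ k / k`!%:R.

Lemma pois_ge0 mu k : 0 <= mu -> 0 <= pois mu k.
Proof. by move=> mu0; rewrite divr_ge0// mulr_ge0 ?expR_ge0// exprn_ge0. Qed.

Lemma pois0 mu : pois mu 0 = expR (- mu).
Proof. by rewrite /pois expr0 mulr1 divr1. Qed.

Lemma pois1 mu : pois mu 1 = expR (- mu) * mu.
Proof. by rewrite /pois expr1 divr1. Qed.

Lemma poisS mu k : k.+1%:R * pois mu k.+1 = mu * pois mu k.
Proof.
have a0 : k.+1%:R != 0 :> R by rewrite pnatr_eq0.
have b0 : k`!%:R != 0 :> R by rewrite pnatr_eq0 -lt0n fact_gt0.
rewrite /pois factS natrM exprS; move: a0 b0; move: k.+1%:R k`!%:R => a b a0 b0.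
by field; rewrite a0 b0.
Qed.

Lemma poisson_prob1 mu j k : 0 <= mu -> poisson_prob mu j [set k] = (pois mu k)%:E.
Proof.
rewrite le_eqVlt => /orP[/eqP <-|mu0]; rewrite /poisson_prob.
  rewrite ltxx /pois oppr0 expR0 mul1r expr0n diracE.
  case: k => [|k]; first by rewrite mem_set// divr1.
  by rewrite memNset// mul0r.
by rewrite mu0 esum_set1 ?lee_fin ?poisson_pmf_ge0// /poisson_pmf mu0 /pois; congr EFin; ring.
Qed.

Lemma pois_sum mu : 0 <= mu -> (\sum_(0 <= k <oo) (pois mu k)%:E = 1)%E.
Proof.
move=> mu0.
rewrite [RHS](_ : _ = (expR (- mu))%:E * (expR mu)%:E)%E; last first.
  by rewrite -EFinM expRN mulVf ?gt_eqF ?expR_gt0.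
under eq_eseriesr.
  move=> n _; rewrite /pois -mulrA EFinM; over.
rewrite /= nneseriesZl/=; last first.
  by move=> n _; rewrite lee_fin divr_ge0// exprn_ge0.
congr (_ * _)%E; rewrite expRE -EFin_lim; last first.
  rewrite /pseries/=; under eq_fun do rewrite mulrC.
  exact: is_cvg_series_exp_coeff.
apply/congr_lim/funext => n/=; rewrite /pseries/= /series/= -sumEFin//.
by under eq_bigr do rewrite mulrC.
Qed.

Lemma pois_mean mu : 0 <= mu -> (\sum_(0 <= k <oo) (k%:R * pois mu k)%:E = mu%:E)%E.
Proof.
move=> mu0; have h k : (0 <= (k%:R * pois mu k)%:E)%E.
  by rewrite lee_fin mulr_ge0// pois_ge0.
rewrite nneseries_recl// mul0r add0e -(nneseries_addn 1)//.
under eq_eseriesr do rewrite addn1 poisS EFinM.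
by rewrite nneseriesZl ?pois_sum ?mule1// => i _; rewrite lee_fin pois_ge0.
Qed.

(** The second factorial moment, that is the expected number of ordered pairs of distinct points;
    the index shift [poisS] reduces it to the mean. *)
Lemma pois_fact2 mu : 0 <= mu ->
  (\sum_(0 <= k <oo) ((k * k.-1)%:R * pois mu k)%:E = (mu ^+ 2)%:E)%E.
Proof.
move=> mu0; have h k : (0 <= ((k * k.-1)%:R * pois mu k)%:E)%E.
  by rewrite lee_fin mulr_ge0// pois_ge0.
rewrite nneseries_recl// mul0n mul0r add0e -(nneseries_addn 1)//.
under eq_eseriesr do rewrite addn1 /= natrM mulrAC poisS -mulrA (mulrC (pois _ _)) EFinM.
rewrite nneseriesZl ?pois_mean//.
by move=> i _; rewrite lee_fin mulr_ge0// pois_ge0.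
Qed.

Lemma pois_partial_le1 mu n : 0 <= mu -> \sum_(k < n) pois mu k <= 1.
Proof.
move=> mu0; rewrite -lee_fin -(pois_sum mu0) -sumEFin -(big_mkord xpredT (fun k => (pois mu k)%:E)).
by apply: nneseries_lim_ge => k _ _; rewrite lee_fin pois_ge0.
Qed.

(** Markov's inequality: the tail from [n] on is at most [mu / n <= 1 / 2]. *)
Lemma pois_head_ge mu n : 0 <= mu -> 2 * mu <= n%:R -> (0 < n)%N ->
  1 / 2 <= \sum_(k < n) pois mu k.
Proof.
move=> mu0 mun n0.
have nR : 0 < n%:R :> R by rewrite ltr0n.
suff : 1 <= \sum_(k < n) pois mu k + mu / n%:R.
  have : mu / n%:R <= 1 / 2 by rewrite ler_pdivrMr//; lra.
  lra.
rewrite -lee_fin -(pois_sum mu0); apply: lime_le.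
  by apply: is_cvg_nneseries => k _ _; rewrite lee_fin pois_ge0.
near=> N; rewrite sumEFin lee_fin.
have nN : (n <= N)%N by near: N; exists n.
rewrite (big_cat_nat _ nN)//= big_mkord lerD2l.
have : \sum_(n <= k < N) k%:R * pois mu k <= mu.
  rewrite -lee_fin -(pois_mean mu0).
  apply: (@le_trans _ _ (\sum_(0 <= k < N) (k%:R * pois mu k)%:E)%E); last first.
    by apply: nneseries_lim_ge => k _ _; rewrite lee_fin mulr_ge0// pois_ge0.
  rewrite sumEFin lee_fin [leRHS](big_cat_nat _ nN)//= lerDr.
  by apply: sumr_ge0 => k _; rewrite mulr_ge0// pois_ge0.
move=> h; rewrite ler_pdivlMr// mulr_suml; apply: le_trans h.
rewrite big_nat_cond [leRHS]big_nat_cond; apply: ler_sum => k /andP[/andP[nk _] _].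
by rewrite mulrC ler_wpM2r ?pois_ge0// ler_nat.
Unshelve. all: by end_near. Qed.

(* A Chernoff bound: [pois mu k = 2 ^+ k * expR (- (mu / 2)) * pois (mu / 2) k]. *)
Lemma pois_head_le mu K : 0 <= mu ->
  \sum_(k < K.+1) pois mu k <= 2 ^+ K * expR (- (mu / 2)).
Proof.
move=> mu0.
apply: (@le_trans _ _ (\sum_(k < K.+1) 2 ^+ K * expR (- (mu / 2)) * pois (mu / 2) k)).
  apply: ler_sum => k _.
  have -> : pois mu k = 2 ^+ k * expR (- (mu / 2)) * pois (mu / 2) k.
    rewrite /pois expr_div_n; have -> : - mu = - (mu / 2) + - (mu / 2) by field.
    rewrite expRD; field.
    by rewrite pnatr_eq0 -lt0n fact_gt0 expf_neq0.
  rewrite ler_wpM2r ?pois_ge0 ?divr_ge0// ler_wpM2r ?expR_ge0//.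
  by apply: ler_weXn2l; [lra|rewrite -ltnS].
rewrite -mulr_sumr ler_piMr ?mulr_ge0 ?expR_ge0//.
by apply: pois_partial_le1; rewrite divr_ge0.
Qed.

End PoissonSeries.

(** * Comparison of integrals without measurability *)

Section LowerIntegral.
Import HBNNSimple.
Context d (T : measurableType d) (R : realType) (mu : {measure set T -> \bar R}).
Local Open Scope ereal_scope.

(* The integral of a nonnegative function is a supremum over simple functions,
   so that it is monotone without any measurability of the smaller function. *)
Lemma ae_le_integral_nonmeasurable (f g : T -> \bar R) :
  (forall x, 0 <= f x) -> (forall x, 0 <= g x) -> measurable_fun setT g ->
  {ae mu, forall x, f x <= g x} -> \int[mu]_x f x <= \int[mu]_x g x.
Proof.
move=> f0 g0 mg fg; rewrite [leLHS]ge0_integralTE//.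
apply: ge_ereal_sup => _ [h hf <-]; rewrite -integralT_nnsfun.
apply: ae_ge0_le_integral => //.
- by move=> x _; rewrite lee_fin; exact: fun_ge0.
- by apply/measurable_EFinP; exact: measurable_funPT.
- by apply: filterS fg => x fgx _; apply: le_trans (hf x) fgx.
Qed.

Lemma le_integral_nonmeasurable (f g : T -> \bar R) :
  (forall x, 0 <= f x) -> (forall x, f x <= g x) ->
  \int[mu]_x f x <= \int[mu]_x g x.
Proof.
move=> f0 fg; have g0 x : 0 <= g x by apply: le_trans (fg x).
rewrite !ge0_integralTE//; apply: le_ereal_sup => _ [h hf <-]; exists h => // x.
by apply: le_trans (hf x) (fg x).
Qed.

End LowerIntegral.

(** * Count events and the expected number of pairs next to an empty region *)

Section Process.
Context {R : realType} d (Omega : measurableType d) (P : probability Omega R).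
Variables (l : R) (X : Omega -> set 'rV[R]_4).
Hypotheses (l0 : 0 < l) (hX : clifford_poisson_process P l X).
Implicit Types (S T A Q : set (R * R)).

Definition cnt S k := count_event X (clifford_map @` S) k.

Lemma measurable_cnt S k : torus_measurable S -> measurable (cnt S k).
Proof.
by move=> mS; have [_ h _] := hX; have [] := h _ (borel_in_torus_image mS) k.
Qed.

Lemma rate_ge0 S : 0 <= l * area S.
Proof. by rewrite mulr_ge0 ?area_ge0// ltW. Qed.
Hint Resolve rate_ge0 : core.

Lemma P_cnt S k : torus_measurable S -> P (cnt S k) = (pois (l * area S) k)%:E.
Proof.
move=> mS; have [_ h _] := hX; have [_] := h _ (borel_in_torus_image mS) k.
by rewrite mes2_image// poisson_prob1.
Qed.

Lemma P_cnt_indep m (S : 'I_m -> set (R * R)) (k : 'I_m -> nat) :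
  (forall i, torus_measurable (S i)) -> trivIset setT S ->
  P (\bigcap_i cnt (S i) (k i)) = (\prod_(i < m) pois (l * area (S i)) (k i))%:E.
Proof.
move=> mS tS; have [_ _ h] := hX; rewrite h.
- rewrite -prodEFin; apply: eq_bigr => i _; exact: P_cnt.
- by move=> i; apply: borel_in_torus_image.
- apply/trivIsetP => i j _ _ ij; apply: image_disjoint.
  + exact: (mS i).2.
  + exact: (mS j).2.
  + by move/trivIsetP : tS; apply.
Qed.

Lemma P_cnt2 S T j k : torus_measurable S -> torus_measurable T -> S `&` T = set0 ->
  P (cnt S j `&` cnt T k) = (pois (l * area S) j * pois (l * area T) k)%:E.
Proof.
move=> mS mT ST.
pose F (i : 'I_2) := if i == ord0 then S else T.
pose g (i : 'I_2) := if i == ord0 then j else k.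
have -> : cnt S j `&` cnt T k = \bigcap_i cnt (F i) (g i).
  apply/seteqP; split=> [w [wS wT] i _|w H].
    by rewrite /F /g; case: ifP.
  by split; [have := H ord0 I|have := H ord_max I].
rewrite P_cnt_indep.
- by rewrite !big_ord_recl big_ord0 /F /g /= mulr1.
- by move=> i; rewrite /F; case: ifP.
- apply/trivIsetP => a b _ _; rewrite /F.
  case: (unliftP ord0 a) => [a'|] ->; case: (unliftP ord0 b) => [b'|] ->; rewrite ?ord1//=.
  by rewrite setIC.
Qed.

Definition finite_event := \bigcup_k cnt angle_square k.

Lemma finite_eventP w : finite_event w <-> finite_set (X w).
Proof.
have [XT _ _] := hX.
have XE : X w `&` clifford_map @` angle_square = X w by apply: setIidl; exact: XT.
rewrite finite_setP; split=> [[k _]|[k hk]].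
  by rewrite /cnt /count_event /= XE => hk; exists k.
by exists k => //; rewrite /cnt /count_event /= XE.
Qed.

Definition ncount w S := #|` fset_set (X w `&` clifford_map @` S)|.

Lemma cntP w S k : finite_set (X w) -> cnt S k w <-> ncount w S = k.
Proof.
move=> fX; have fS : finite_set (X w `&` clifford_map @` S) by exact: finite_setIl.
split=> [h|<-]; first exact: card_fset_set.
have [n hn] := (finite_setP _).1 fS.
by rewrite /cnt /count_event/= /ncount (card_fset_set hn).
Qed.

Lemma measurable_finite_event : measurable finite_event.
Proof.
by apply: bigcupT_measurable => k; apply: measurable_cnt; exact: torus_measurable_square.
Qed.

(** The events of having exactly [k] points in the torus are disjoint, and the Poisson weights add
    up to 1. *)
Lemma P_finite_event : P finite_event = 1%E.
Proof.
rewrite /finite_event measure_semi_bigcup.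
- rewrite -(pois_sum (rate_ge0 angle_square)); apply: eq_eseriesr => k _.
  by apply: P_cnt; exact: torus_measurable_square.
- by move=> k; apply: measurable_cnt; exact: torus_measurable_square.
- apply/trivIsetP => i j _ _ ij; apply/seteqP; split=> // w [wi wj].
  have fX : finite_set (X w) by apply/finite_eventP; exists i.
  move/(cntP _ _ fX) : wi => wi; move/(cntP _ _ fX) : wj => wj.
  by move: ij; rewrite -wi -wj eqxx.
- exact: measurable_finite_event.
Qed.

Lemma ae_finite : {ae P, forall w, finite_set (X w)}.
Proof.
have : P.-negligible (~` finite_event).
  apply/negligibleP; first by apply: measurableC; exact: measurable_finite_event.
  suff : P (~` finite_event) = 0%E by [].
  by rewrite probability_setC ?P_finite_event ?subee//; exact: measurable_finite_event.
by apply: negligibleS => w /= nw /finite_eventP.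
Qed.

Local Open Scope ereal_scope.

(** For finite [X w]: the number of ordered pairs of distinct points in [A] if [Q] is empty, and 0
    otherwise. As a series of indicators of count events it is measurable and can be integrated
    termwise. *)
Definition pair_count Q A w : \bar R :=
  \sum_(0 <= k <oo) ((k * k.-1)%:R%:E * (\1_(cnt Q 0 `&` cnt A k) w)%:E).

Lemma pair_count_ge0 Q A w : 0 <= pair_count Q A w.
Proof. by apply: nneseries_ge0 => k _ _; rewrite mule_ge0// lee_fin. Qed.

Lemma measurable_pair_count Q A : torus_measurable Q -> torus_measurable A ->
  measurable_fun setT (pair_count Q A).
Proof.
move=> mQ mA; apply: (@ge0_emeasurable_sum _ _ _ _ _ xpredT).
  by move=> k x _ _; rewrite mule_ge0// lee_fin.
move=> k _; apply: measurable_funeM; apply/measurable_EFinP.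
by apply: measurable_indic; apply: measurableI; exact: measurable_cnt.
Qed.

Lemma integral_pair_count Q A : torus_measurable Q -> torus_measurable A ->
  Q `&` A = set0 ->
  \int[P]_w pair_count Q A w = (expR (- (l * area Q)) * (l * area A) ^+ 2)%:E.
Proof.
move=> mQ mA QA; have mC k : measurable (cnt Q 0 `&` cnt A k).
  by apply: measurableI; exact: measurable_cnt.
have mf k : measurable_fun setT (fun w => (\1_(cnt Q 0 `&` cnt A k) w : R)%:E).
  by apply/measurable_EFinP; exact: measurable_indic.
have g0 k w : 0 <= (k * k.-1)%:R%:E * ((\1_(cnt Q 0 `&` cnt A k) w : R)%:E).
  by rewrite mule_ge0// lee_fin.
rewrite (integral_nneseries _ measurableT (fun k => measurable_funeM _ (mf k)) (fun k w _ => g0 k w)).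
rewrite -pois0 EFinM -pois_fact2// -nneseriesZl; last first.
  by move=> k _; rewrite lee_fin mulr_ge0// pois_ge0.
apply: eq_eseriesr => k _.
rewrite ge0_integralZl_EFin//.
rewrite integral_indic// setIT.
transitivity ((k * k.-1)%:R%:E * P (cnt Q 0 `&` cnt A k)) => //.
by rewrite P_cnt2// -!EFinM; congr EFin; rewrite mulrCA.
Qed.

Lemma pair_count_ge Q A w : finite_set (X w) -> ncount w Q = 0%N ->
  (ncount w A * (ncount w A).-1)%:R%:E <= pair_count Q A w.
Proof.
move=> fX Q0; set n := ncount w A.
rewrite /pair_count; apply: le_trans (nneseries_lim_ge n.+1 _); last first.
  by move=> k _ _; rewrite mule_ge0// lee_fin.
rewrite big_nat_recr//= -[leLHS]add0e; apply: leeD.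
  by apply: sume_ge0 => k _; rewrite mule_ge0// lee_fin.
rewrite indicE mem_set ?mule1//; split; exact/cntP.
Qed.

End Process.

(** * The upper bound *)

Section PairCounting.
Context {R : realType}.
Local Notation E4 := ('rV[R]_4).
Implicit Types (Y : set E4) (S : set (R * R)).

Definition offdiag Y : set (E4 * E4) := [set pq | [/\ Y pq.1, Y pq.2 & pq.1 != pq.2]].

Lemma finite_offdiag Y : finite_set Y -> finite_set (offdiag Y).
Proof.
move=> fY; apply: (@sub_finite_set _ _ (Y `*` Y)); last exact: finite_setX.
by move=> pq [].
Qed.

Lemma card_fset_set_seq (T : choiceType) (D : set T) (s : seq T) :
  finite_set D -> (forall x, D x -> x \in s) -> (#|` fset_set D| <= size s)%N.
Proof.
move=> fD Ds; apply: (@leq_trans #|` [fset x in s]|%fset).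
  by apply: fsubset_leq_card; apply/fsubsetP => x; rewrite in_fset_set// !inE => /Ds.
by rewrite card_fseq size_undup.
Qed.

Lemma card_setX_le Y : finite_set Y ->
  (#|` fset_set (Y `*` Y)| <= #|` fset_set Y| * #|` fset_set Y|)%N.
Proof.
move=> fY; rewrite -(size_allpairs pair); apply: card_fset_set_seq.
  exact: finite_setX.
by move=> [p q] [/= Yp Yq]; apply: allpairs_f; rewrite in_fset_set// inE.
Qed.

Lemma card_offdiag_le Y : finite_set Y ->
  (#|` fset_set (offdiag Y)| <= #|` fset_set Y| * #|` fset_set Y|.-1)%N.
Proof.
move=> fY; set s := (fset_set Y : seq E4).
have -> : (#|` fset_set Y| * #|` fset_set Y|.-1)%N =
    size [seq (x, y) | x <- s, y <- rem x s].
  rewrite size_allpairs_dep -[LHS]/(size s * (size s).-1)%N.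
  have -> : [seq size (rem x s) | x <- s] = nseq (size [seq size (rem x s) | x <- s]) (size s).-1.
    by apply/all_pred1P/allP => _ /mapP[x xs ->] /=; rewrite size_rem.
  by rewrite sumn_nseq size_map mulnC.
apply: card_fset_set_seq; first exact: finite_offdiag.
move=> [p q] [/= Yp Yq pq]; apply/allpairsPdep; exists p, q; split=> //.
  by rewrite /s in_fset_set// inE.
by rewrite mem_rem_uniq ?fset_uniq// !inE eq_sym pq/= in_fset_set// inE.
Qed.

Lemma card_bigcup_le (I : choiceType) (T : choiceType) (s : seq I) (B : I -> set T) :
  (forall i, finite_set (B i)) ->
  finite_set (\bigcup_(i in [set` s]) B i) /\
  (#|` fset_set (\bigcup_(i in [set` s]) B i)| <= \sum_(i <- s) #|` fset_set (B i)|)%N.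
Proof.
move=> fB; rewrite bigcup_seq; elim: s => [|i s [fs IH]].
  by rewrite !big_nil fset_set0; split=> //; exact: finite_set0.
rewrite !big_cons; split; first by rewrite finite_setU.
by rewrite fset_setU//; apply: leq_trans (leq_card_fsetU _ _) _; rewrite leq_add2l.
Qed.

(** A union bound: each edge is charged to an index [x] for which [Q x] has no points and [A x]
    holds both endpoints. The third point of [Y] rules out the zero functional. *)
Lemma face_number1_cover Y (I : choiceType) (s : seq I) (Q A : I -> set (R * R)) :
  finite_set Y -> Y `<=` clifford_torus -> (2 < #|` fset_set Y|)%N ->
  (forall (u : E4) c t t', u != 0 -> Y `<=` [set x | dot u x <= c] ->
     angle_square t -> angle_square t' -> Y (clifford_map t) -> Y (clifford_map t') ->
     dot u (clifford_map t) = c -> dot u (clifford_map t') = c ->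
     exists x, [/\ x \in s, forall r, Y (clifford_map r) -> ~ Q x r, A x t & A x t']) ->
  (face_number (convex_hull Y) 1 <=
   \sum_(x <- s | `[< Y `&` clifford_map @` (Q x) = set0 >])
     #|` fset_set (offdiag (Y `&` clifford_map @` (A x)))|)%N.
Proof.
move=> fY YT Y3 H.
pose B x := if `[< Y `&` clifford_map @` (Q x) = set0 >]
  then offdiag (Y `&` clifford_map @` (A x)) else set0.
have fB x : finite_set (B x).
  by rewrite /B; case: ifP => // _; apply: finite_offdiag; exact: finite_setIl.
have [fD Dle] := card_bigcup_le s fB.
have -> : (\sum_(x <- s | `[< Y `&` clifford_map @` (Q x) = set0 >])
     #|` fset_set (offdiag (Y `&` clifford_map @` (A x)))| = \sum_(x <- s) #|` fset_set (B x)|)%N.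
  by rewrite big_mkcond; apply: eq_bigr => x _; rewrite /B; case: ifP => // _; rewrite fset_set0.
apply: leq_trans Dle; apply: (@face_number1_le _ _ 2) => //.
  by move=> x /YT; exact: clifford_torus_sphere.
move=> F p q KF F1 Yp Yq Fp Fq pq.
have [t sqt tp] := YT _ Yp; have [t' sqt' tq] := YT _ Yq.
have [u [c [Ku Fu]]] := KF.
have up : dot u p = c by move: Fp; rewrite Fu => -[].
have uq : dot u q = c by move: Fq; rewrite Fu => -[].
have Yu : Y `<=` [set x | dot u x <= c].
  by move=> x Yx; apply: Ku; exact: sub_convex_hull.
have u0 : u != 0.
  (* For [u = 0] the face is the whole hull, of dimension 1 only if [Y] has two points. *)
  apply/eqP => u0; have c0 : c = 0 by rewrite -up u0 dotC dot0r.
  have FK : F = convex_hull Y.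
    rewrite Fu; apply: setIidl => x _ /=.
    by rewrite -[LHS]/(dot u x) u0 dotC dot0r c0.
  have YF x : Y x -> x = p \/ x = q.
    move=> Yx; apply: (has_dim1_sphere F1 _ _ _ Fp Fq _ pq).
    - exact/clifford_torus_sphere/YT.
    - exact/clifford_torus_sphere/YT.
    - exact/clifford_torus_sphere/YT.
    - by rewrite FK; exact: sub_convex_hull.
  have : (#|` fset_set Y| <= #|` [fset p; q]%fset|)%N.
    apply: fsubset_leq_card; apply/fsubsetP => x; rewrite in_fset_set// inE => /YF[->|->].
      by rewrite !inE eqxx.
    by rewrite !inE eqxx orbT.
  by rewrite cardfs2 pq; move: Y3; lia.
have [x [xs Qx Ax Ax']] : exists x, [/\ x \in s, forall r, Y (clifford_map r) -> ~ Q x r, A x t & A x t'].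
  by apply: (H u c) => //; rewrite ?tp ?tq.
exists x => //; rewrite /B asboolT; last first.
  apply/seteqP; split=> // y [Yy [r Qr ry]]; exfalso; apply: Qx Qr.
  by rewrite ry.
split=> //=; split=> //; [by exists t|by exists t'].
Qed.

(** With more than [K] vertices the denominator is at least [K.+1]. With [n <= K] vertices there are
    at most [n * n] edges, so the valence is at most [2 * n]. *)
Lemma mean_valence_le Y (K : nat) (S : R) :
  finite_set Y -> Y `<=` clifford_torus -> 0 <= S ->
  ((K < #|` fset_set Y|)%N -> (face_number (convex_hull Y) 1)%:R <= S) ->
  mean_valence (convex_hull Y) <=
    2 / K.+1%:R * S + (if (#|` fset_set Y| <= K)%N then 2 * K%:R else 0).
Proof.
move=> fY YT S0 HS; set n := #|` fset_set Y| in HS *.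
have YS : forall x, Y x -> dot x x = 2 by move=> x /YT; exact: clifford_torus_sphere.
rewrite /mean_valence (face_number0 fY YS) -/n.
have KS0 : 0 <= 2 / K.+1%:R * S by rewrite mulr_ge0// divr_ge0.
have [nK|nK] := leqP n K.
  case: eqP => [_|/eqP n0]; first by rewrite addr_ge0.
  have nR : 0 < n%:R :> R by rewrite ltr0n lt0n.
  have f1 : (face_number (convex_hull Y) 1 <= n * n)%N.
    have fYY : finite_set (Y `*` Y) by exact: finite_setX.
    apply: leq_trans (card_setX_le fY).
    by apply: (face_number1_le fY YS).
  apply: (@le_trans _ _ (2 * n%:R)).
    by rewrite ler_pdivrMr// -mulrA ler_pM2l// -natrM ler_nat.
  rewrite -[leLHS]add0r lerD// ler_pM2l// ler_nat//.
rewrite addr0 gtn_eqF; last by apply: leq_ltn_trans nK.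
have nR : 0 < n%:R :> R by rewrite ltr0n; apply: leq_ltn_trans nK.
have KR : 0 < K.+1%:R :> R by rewrite ltr0n.
have f1 := HS nK.
have nV : n%:R^-1 <= K.+1%:R^-1 :> R by rewrite lef_pV2 ?posrE// ler_nat.
rewrite [leRHS]mulrAC; apply: ler_pM => //.
- by rewrite ler_pM2l.
Qed.

End PairCounting.

(** * The union bound over cells and strips *)

Section Regions.
Context {R : realType}.
Local Notation E4 := ('rV[R]_4).
Local Notation pi := (@pi R).

(* [inl ((i, j), (a, b))] stands for the cell [a, b] of the grid of scale [i, j],
   [inr] for the strips around the circles of the finest grid. *)
Definition region_index := ((nat * nat) * (nat * nat) + (nat + nat))%type.

Definition empty_region (x : region_index) : set (R * R) :=
  match x with
  | inl ((i, j), (a, b)) => (cell i a `&` circle) `*` (cell j b `&` circle)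
  | inr _ => set0
  end.

(** Removing the empty cell makes the counts of the two regions independent and loses no endpoint,
    as an endpoint is a point of the process and cannot lie in an empty cell. *)
Definition pair_region n (x : region_index) : set (R * R) :=
  match x with
  | inl ((i, j), (a, b)) => ((nbhd i a `&` circle) `*` (nbhd j b `&` circle)) `\`
      empty_region x
  | inr (inl a) => (nbhd n a `&` circle) `*` circle
  | inr (inr b) => circle `*` (nbhd n b `&` circle)
  end.

Definition cell_indices n :=
  [seq (ij, ab) | ij <- [seq (i, j) | i <- iota 0 n.+1, j <- iota 0 n.+1],
                  ab <- [seq (a, b) | a <- iota 0 (2 ^ ij.1), b <- iota 0 (2 ^ ij.2)]].

Definition region_indices n : seq region_index :=
  [seq inl x | x <- cell_indices n] ++
  ([seq inr (inl a) | a <- iota 0 (2 ^ n)] ++ [seq inr (inr b) | b <- iota 0 (2 ^ n)]).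

Let mcell i a : measurable (cell i a `&` circle : set R).
Proof. by apply: measurableI; [exact: measurable_cell|exact: measurable_circle]. Qed.

Let mnbhd i a : measurable (nbhd i a `&` circle : set R).
Proof. by apply: measurableI; [exact: measurable_nbhd|exact: measurable_circle]. Qed.

Lemma torus_measurable_empty_region x : torus_measurable (empty_region x).
Proof.
case: x => [[[i j] [a b]]|x]; last exact: torus_measurable0.
by apply: torus_measurableX => // y [].
Qed.

Lemma torus_measurable_nbhdX i j a b :
  torus_measurable ((nbhd i a `&` circle) `*` (nbhd j b `&` circle) : set (R * R)).
Proof. by apply: torus_measurableX => // y []. Qed.

Lemma torus_measurable_pair_region n x : torus_measurable (pair_region n x).
Proof.
have mC := @measurable_circle R.
case: x => [[[i j] [a b]]|[a|b]].
- apply: torus_measurableD; first exact: torus_measurable_nbhdX.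
  exact: (torus_measurable_empty_region (inl ((i, j), (a, b)))).
- by apply: torus_measurableX => // y [].
- by apply: torus_measurableX => // y [].
Qed.

Lemma regions_disjoint n x : empty_region x `&` pair_region n x = set0.
Proof.
case: x => [[[i j] [a b]]|x] /=; last by rewrite set0I.
by apply/seteqP; split=> // t [h [_]].
Qed.

Lemma regions_cover n (Y : set E4) (u : E4) c (t t' : R * R) :
  u != 0 -> Y `<=` [set x | dot u x <= c] ->
  angle_square t -> angle_square t' -> Y (clifford_map t) -> Y (clifford_map t') ->
  dot u (clifford_map t) = c -> dot u (clifford_map t') = c ->
  exists x, [/\ x \in region_indices n, forall r, Y (clifford_map r) -> ~ empty_region x r,
    pair_region n x t & pair_region n x t'].
Proof.
move=> u0 Yu sqt sqt' Yt Yt' ut ut'.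
have [[i [j [a [b [/andP[hi hj] /andP[ha hb] At At' Q0]]]]]|[a [ha At At']]|[b [hb At At']]] :=
    edge_cover n Yu u0 sqt sqt' ut ut'.
- have Q0' r : Y (clifford_map r) -> ~ empty_region (inl ((i, j), (a, b))) r.
    by move=> Yr [[r1 _] [r2 _]]; apply: (Q0 r Yr).
  exists (inl ((i, j), (a, b))); split=> //.
  + rewrite mem_cat; apply/orP; left; apply: map_f.
    apply/allpairsPdep; exists (i, j), (a, b); split=> //.
      by apply: allpairs_f; rewrite mem_iota.
    by apply: allpairs_f; rewrite mem_iota.
  + split; last exact: Q0'.
    by case: At sqt => ? ? [? ?]; split; split.
  + split; last exact: Q0'.
    by case: At' sqt' => ? ? [? ?]; split; split.
- exists (inr (inl a)); split; [|by move=> r _ []| |].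
  + rewrite !mem_cat; apply/orP; right; apply/orP; left; apply: map_f.
    by rewrite mem_iota.
  + by case: sqt => ? ?; split=> //; split.
  + by case: sqt' => ? ?; split=> //; split.
- exists (inr (inr b)); split; [|by move=> r _ []| |].
  + rewrite !mem_cat; apply/orP; right; apply/orP; right; apply: map_f.
    by rewrite mem_iota.
  + by case: sqt => ? ?; split=> //; split.
  + by case: sqt' => ? ?; split=> //; split.
Qed.

Lemma mean_valence_ge0 (K : set E4) : 0 <= mean_valence K.
Proof. by rewrite /mean_valence; case: ifP => // _; rewrite divr_ge0// mulr_ge0. Qed.

Context d (Omega : measurableType d) (P : probability Omega R).
Variables (l : R) (X : Omega -> set 'rV[R]_4).
Hypotheses (l0 : 0 < l) (hX : clifford_poisson_process P l X).

Lemma valence_pointwise_le n K w : (2 <= K)%N -> finite_set (X w) ->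
  ((mean_valence (convex_hull (X w)))%:E <=
   (2 / K.+1%:R)%:E * (\sum_(x <- region_indices n)
      pair_count X (empty_region x) (pair_region n x) w) +
   \sum_(k < K.+1) (2 * K%:R)%:E * (\1_(cnt X angle_square k) w)%:E)%E.
Proof.
move=> K2 fX; have [XT _ _] := hX.
pose S : nat := (\sum_(x <- region_indices n |
    `[< X w `&` clifford_map @` (empty_region x) = set0 >])
  #|` fset_set (offdiag (X w `&` clifford_map @` (pair_region n x)))|)%N.
have nE : ncount X w angle_square = #|` fset_set (X w)|.
  by rewrite /ncount (_ : X w `&` _ = X w)//; apply: setIidl; exact: XT.
have h := @mean_valence_le R (X w) K S%:R fX (XT w) (ler0n _ _).
have {}h : mean_valence (convex_hull (X w)) <= 2 / K.+1%:R * S%:R +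
     (if (#|` fset_set (X w)| <= K)%N then 2 * K%:R else 0).
  apply: h => Kn; rewrite ler_nat; apply: face_number1_cover => //.
    exact: leq_ltn_trans Kn.
  by move=> u c t t'; exact: regions_cover.
apply: (@le_trans _ _ (2 / K.+1%:R * S%:R +
     (if (#|` fset_set (X w)| <= K)%N then 2 * K%:R else 0))%:E); first by rewrite lee_fin.
rewrite EFinD; apply: leeD.
  rewrite EFinM; apply: lee_wpmul2l; first by rewrite lee_fin divr_ge0.
  rewrite /S natr_sum -sumEFin big_mkcond; apply: lee_sum => x _.
  case: asboolP => Q0; last exact: pair_count_ge0.
  have fA : finite_set (X w `&` clifford_map @` (pair_region n x)) by exact: finite_setIl.
  apply: (@le_trans _ _ (ncount X w (pair_region n x) * (ncount X w (pair_region n x)).-1)%:R%:E).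
    by rewrite lee_fin ler_nat; exact: card_offdiag_le.
  by apply: pair_count_ge => //; rewrite /ncount Q0 fset_set0 cardfs0.
case: ifPn => nK; last first.
  by apply: sume_ge0 => k _; rewrite mule_ge0// lee_fin// mulr_ge0.
rewrite -nE -ltnS in nK.
rewrite (bigD1 (Ordinal nK))//= indicE mem_set; last exact/cntP.
rewrite mule1 leeDl//; apply: sume_ge0 => k _.
by rewrite mule_ge0// lee_fin// mulr_ge0.
Qed.

Lemma expected_valence_le n K : (2 <= K)%N ->
  (\int[P]_w (mean_valence (convex_hull (X w)))%:E <=
   (2 / K.+1%:R * (\sum_(x <- region_indices n)
      expR (- (l * area (empty_region x))) * (l * area (pair_region n x)) ^+ 2) +
    2 * K%:R * \sum_(k < K.+1) pois (l * area angle_square) k)%:E)%E.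
Proof.
move=> K2.
have mC k : measurable (cnt X angle_square k).
  by apply: (measurable_cnt hX); exact: torus_measurable_square.
pose pc x w := pair_count X (empty_region x) (pair_region n x) w.
have pc0 x w : (0 <= pc x w)%E by exact: pair_count_ge0.
have mpc x : measurable_fun setT (pc x).
  apply: (measurable_pair_count hX); first exact: torus_measurable_empty_region.
  exact: torus_measurable_pair_region.
pose f1 w := ((2 / K.+1%:R)%:E * (\sum_(x <- region_indices n) pc x w))%E.
pose g k w := ((2 * K%:R : R)%:E * (\1_(cnt X angle_square k) w : R)%:E)%E.
have g0 k w : (0 <= g k w)%E by rewrite mule_ge0// lee_fin// mulr_ge0.
have mg k : measurable_fun setT (g k).
  by apply: measurable_funeM; apply/measurable_EFinP; exact: measurable_indic.
have f10 w : (0 <= f1 w)%E.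
  by apply: mule_ge0; [rewrite lee_fin divr_ge0|exact: sume_ge0].
have ms : measurable_fun setT (fun w => (\sum_(x <- region_indices n) pc x w)%E).
  exact: emeasurable_sum.
have mf1 : measurable_fun setT f1 by exact: measurable_funeM.
pose f2 w := (\sum_(k < K.+1) g k w)%E.
have mf2 : measurable_fun setT f2 by apply: emeasurable_sum => k; exact: mg.
have f20 w : (0 <= f2 w)%E by exact: sume_ge0.
apply: (@le_trans _ _ (\int[P]_w (f1 w + f2 w))%E).
  apply: ae_le_integral_nonmeasurable.
  - by move=> w; rewrite lee_fin mean_valence_ge0.
  - by move=> w; rewrite adde_ge0.
  - exact: emeasurable_funD.
  - by apply: filterS (ae_finite l0 hX) => w fX; exact: valence_pointwise_le.
rewrite ge0_integralD// EFinD; apply: leeD.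
  rewrite ge0_integralZl_EFin//; last first.
  - by move=> w _; exact: sume_ge0.
  rewrite ge0_integral_sum// [in leRHS]EFinM -sumEFin le_eqVlt; apply/orP; left; apply/eqP.
  congr (_ * _)%E; apply: eq_bigr => x _; apply: (integral_pair_count l0 hX).
  - exact: torus_measurable_empty_region.
  - exact: torus_measurable_pair_region.
  - exact: regions_disjoint.
rewrite ge0_integral_sum// mulr_sumr -sumEFin le_eqVlt; apply/orP; left; apply/eqP.
apply: eq_bigr => k _.
have mi : measurable_fun setT (fun w => (\1_(cnt X angle_square k) w : R)%:E).
  by apply/measurable_EFinP; exact: measurable_indic.
rewrite (ge0_integralZl_EFin _ measurableT _ mi)//.
rewrite integral_indic// setIT [in RHS]EFinM; congr (_ * _)%E.
by apply: (P_cnt l0 hX); exact: torus_measurable_square.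
Qed.

End Regions.

(** * Summation of the expected pairs over all scales *)

Section UpperNumerics.
Context {R : realType}.
Local Notation pi := (@pi R).
Implicit Types (m L l : R).

Lemma expRN_le_inv m : 0 < m -> expR (- m) <= m^-1.
Proof.
move=> m0; rewrite expRN lef_pV2 ?posrE ?expR_gt0//.
by apply: le_trans (expR_ge1Dx _); rewrite lerDr.
Qed.

Lemma mul_expRN_le m : 0 <= m -> m * expR (- m) <= m.
Proof. by move=> m0; rewrite ler_piMr// -expR0 ler_expR oppr_le0. Qed.

(** [expR (- m)] is the square of [expR (- (m / 2))], which is at most [2 / m]. *)
Lemma mul_expRN_le_inv m : 0 < m -> m * expR (- m) <= 4 / m.
Proof.
move=> m0; have m2 : 0 < m / 2 by rewrite divr_gt0.
have -> : expR (- m) = expR (- (m / 2)) ^+ 2.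
  by rewrite -expRM_natl; congr expR; rewrite mulr_natl -mulr_natr; field.
apply: (@le_trans _ _ (m * (m / 2)^-1 ^+ 2)).
  rewrite ler_pM2l//; apply: lerXn2r; last exact: expRN_le_inv.
    by rewrite nnegrE expR_ge0.
  by rewrite nnegrE invr_ge0 ltW.
by rewrite le_eqVlt; apply/orP; left; apply/eqP; field; rewrite gt_eqF.
Qed.

Lemma sum_pow2_le n : \sum_(s < n) 2 ^+ s <= 2 ^+ n :> R.
Proof.
elim: n => [|n IH]; first by rewrite big_ord0.
by rewrite big_ord_recr/= exprS; lra.
Qed.

Lemma sum_pow2V_le a n : \sum_(s < n) (2 ^+ (a + s))^-1 <= 2 / 2 ^+ a :> R.
Proof.
suff h : \sum_(s < n) (2 ^+ (a + s))^-1 <= 2 / 2 ^+ a - 2 / 2 ^+ (a + n) :> R.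
  by apply: le_trans h _; rewrite gerBl divr_ge0// exprn_ge0.
elim: n => [|n IH]; first by rewrite big_ord0 addn0 subrr.
rewrite big_ord_recr/=; apply: (le_trans (lerD IH (lexx _))).
rewrite addnS exprS; have : 2 ^+ (a + n) != 0 :> R by rewrite expf_neq0.
move: (2 ^+ (a + n)) (2 ^+ a)^-1 => x y x0.
by rewrite le_eqVlt; apply/orP; left; apply/eqP; field.
Qed.

(* The terms of the sum decrease geometrically on both sides of s = k. *)
Lemma sum_scales_le L k N : 2 ^+ k <= L -> L < 2 ^+ k.+1 ->
  \sum_(s < N) (L / 2 ^+ s) * expR (- (L / 2 ^+ s)) <= 10.
Proof.
move=> kL Lk; have L0 : 0 < L by apply: lt_le_trans kL; rewrite exprn_gt0.
pose g s := (L / 2 ^+ s) * expR (- (L / 2 ^+ s)).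
have m0 s : 0 < L / 2 ^+ s by rewrite divr_gt0 ?exprn_gt0.
have g0 s : 0 <= g s by rewrite mulr_ge0 ?expR_ge0 ?ltW.
apply: (@le_trans _ _ (\sum_(s < k.+1 + N) g s)).
  by rewrite addnC big_split_ord/= lerDl; exact: sumr_ge0.
rewrite big_split_ord/=.
(* Scales with mean [L / 2 ^+ s] at least 1: the bound [4 / m] sums to at most
   [4 / L * 2 ^+ k.+1 <= 8]. *)
have h1 : \sum_(s < k.+1) g (lshift N s) <= 8.
  apply: (@le_trans _ _ (4 / L * \sum_(s < k.+1) 2 ^+ s)).
    rewrite mulr_sumr; apply: ler_sum => s _; apply: le_trans (mul_expRN_le_inv (m0 _)) _.
    by rewrite invf_div mulrA mulrAC.
  have := sum_pow2_le k.+1; rewrite exprS => h.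
  have : 4 / L * (2 * 2 ^+ k) <= 8.
    by rewrite mulrAC ler_pdivrMr//; lra.
  apply: le_trans; rewrite ler_pM2l// divr_gt0//.
(* Scales with mean below 1: the bound [m] sums to at most [2 * L / 2 ^+ k.+1 <= 2]. *)
have h2 : \sum_(s < N) g (rshift k.+1 s) <= 2.
  apply: (@le_trans _ _ (L * \sum_(s < N) (2 ^+ (k.+1 + s))^-1)).
    by rewrite mulr_sumr; apply: ler_sum => s _; exact: mul_expRN_le (ltW (m0 _)).
  apply: (@le_trans _ _ (L * (2 / 2 ^+ k.+1))).
    by rewrite ler_pM2l//; exact: sum_pow2V_le.
  by rewrite mulrA ler_pdivrMr ?exprn_gt0//; lra.
lra.
Qed.

Definition expected_pairs n l (x : region_index) : R :=
  expR (- (l * area (empty_region x))) * (l * area (pair_region n x)) ^+ 2.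

(** Here [m] is the mean number of points in the cell. In each coordinate the neighbourhood has
    measure at most 78 cell widths, so its mean is at most [78 ^+ 2 * m], and this gets squared. *)
Lemma expected_pairs_cell n l i j a b m : 0 < l -> (a < 2 ^ i)%N -> (b < 2 ^ j)%N ->
  m = l * (2 * pi) ^+ 2 / 2 ^+ (i + j) ->
  expected_pairs n l (inl ((i, j), (a, b))) <= 78 ^+ 4 * m ^+ 2 * expR (- m).
Proof.
move=> l0 ai bj mE.
have cellC i' a' : (a' < 2 ^ i')%N -> cell i' a' `&` circle = cell i' a' :> set R.
  by move=> h; apply: setIidl => x /(cell_sub h) /=; rewrite /circle/= in_itv/=.
have wE : l * (width i * width j) = m.
  by rewrite mE /width exprD; field; rewrite !expf_neq0.
have Q : l * area (empty_region (inl ((i, j), (a, b)))) = m.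
  rewrite /= !cellC// (areaX (a := width i) (b := width j)) ?leb_cell//;
    exact: measurable_cell.
have A : l * area (pair_region n (inl ((i, j), (a, b)))) <= 78 ^+ 2 * m.
  rewrite -wE mulrCA ler_pM2l//.
  apply: (@le_trans _ _ ((78 * width i) * (78 * width j))).
    apply: (@le_trans _ _ (area ((nbhd i a `&` circle) `*` (nbhd j b `&` circle)))).
      apply: area_le; [exact: torus_measurable_pair_region|exact: torus_measurable_nbhdX|].
      by move=> t [].
    apply: areaX_le; [| |exact: leb_nbhd|exact: leb_nbhd];
      by apply: measurableI; [exact: measurable_nbhd|exact: measurable_circle].
  by rewrite le_eqVlt; apply/orP; left; apply/eqP; ring.
rewrite /expected_pairs Q mulrC ler_wpM2r ?expR_ge0//.
have -> : 78 ^+ 4 * m ^+ 2 = (78 ^+ 2 * m) ^+ 2 by ring.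
have A0 : 0 <= l * area (pair_region n (inl ((i, j), (a, b)))).
  by rewrite mulr_ge0 ?area_ge0// ltW.
by apply: lerXn2r => //; rewrite nnegrE// (le_trans A0).
Qed.

(** No region is required to be empty, so no exponential factor appears. The [2 ^ n] strips of one
    direction still contribute [O(L)] in total when [L / 2 ^+ n <= 1]. *)
Lemma expected_pairs_strip n l x : 0 < l ->
  expected_pairs n l (inr x) <= (78 * (l * (2 * pi) ^+ 2 / 2 ^+ n)) ^+ 2.
Proof.
move=> l0; rewrite /expected_pairs /= area_set0 mulr0 oppr0 expR0 mul1r.
have mN a : measurable (nbhd n a `&` circle : set R).
  by apply: measurableI; [exact: measurable_nbhd|exact: measurable_circle].
have lC : (lebesgue_measure (@circle R) <= (2 * pi)%:E)%E by rewrite leb_circle.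
have A : l * area (pair_region n (inr x)) <= 78 * (l * (2 * pi) ^+ 2 / 2 ^+ n).
  have -> : 78 * (l * (2 * pi) ^+ 2 / 2 ^+ n) = l * (78 * width n * (2 * pi)).
    by rewrite /width; field; rewrite expf_neq0.
  rewrite ler_pM2l//; case: x => [a|b].
    by apply: areaX_le; [exact: mN|exact: measurable_circle|exact: leb_nbhd|exact: lC].
  rewrite (mulrC _ (2 * pi)).
  by apply: areaX_le; [exact: measurable_circle|exact: mN|exact: lC|exact: leb_nbhd].
have A0 : 0 <= l * area (pair_region n (inr x)) by rewrite mulr_ge0 ?area_ge0// ltW.
by apply: lerXn2r => //; rewrite nnegrE// (le_trans A0).
Qed.

(** The logarithm arises here. The [2 ^ (i + j)] cells of scale [(i, j)] have mean
    [m = L / 2 ^+ (i + j)] each and together contribute a multiple of [L * (m * expR (- m))]. For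
    fixed [i] the sum over [j] is [O(L)] by [sum_scales_le], and [i] takes [k.+2] values. *)
Lemma expected_pairs_sum k l L : 0 < l -> L = l * (2 * pi) ^+ 2 -> 2 ^+ k <= L -> L < 2 ^+ k.+1 ->
  \sum_(x <- region_indices k.+1) expected_pairs k.+1 l x <=
  L * (10 * 78 ^+ 4 * k.+2%:R + 2 * 78 ^+ 2).
Proof.
move=> l0 LE kL Lk; set n := k.+1.
have L0 : 0 < L by apply: lt_le_trans kL; rewrite exprn_gt0.
rewrite /region_indices !big_cat !big_map.
have strip (f : nat -> nat + nat) :
    \sum_(a <- iota 0 (2 ^ n)) expected_pairs n l (inr (f a)) <= 78 ^+ 2 * L.
  apply: (@le_trans _ _ (\sum_(a <- iota 0 (2 ^ n)) (78 * (L / 2 ^+ n)) ^+ 2)).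
    by apply: ler_sum => a _; rewrite LE; exact: expected_pairs_strip.
  rewrite big_const_seq count_predT size_iota iter_addr addr0 -[leLHS]mulr_natr natrX.
  have -> : (78 * (L / 2 ^+ n)) ^+ 2 * 2 ^+ n = 78 ^+ 2 * (L * (L / 2 ^+ n)).
    by field; rewrite expf_neq0.
  have Ln : L / 2 ^+ n <= 1 by rewrite ler_pdivrMr ?exprn_gt0// mul1r ltW.
  by rewrite ler_pM2l ?exprn_gt0// ler_piMr// ltW.
have s1 := strip inl; have s2 := strip inr.
have cells : \sum_(x <- cell_indices n) expected_pairs n l (inl x) <=
    L * (10 * 78 ^+ 4 * k.+2%:R); last first.
  have -> : L * (10 * 78 ^+ 4 * k.+2%:R + 2 * 78 ^+ 2) =
      L * (10 * 78 ^+ 4 * k.+2%:R) + (78 ^+ 2 * L + 78 ^+ 2 * L) by ring.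
  by apply: lerD => //; apply: lerD.
rewrite /cell_indices big_allpairs_dep big_allpairs.
pose g s := (L / 2 ^+ s) * expR (- (L / 2 ^+ s)).
have g0 s : 0 <= g s by rewrite mulr_ge0 ?expR_ge0// divr_ge0 ?exprn_ge0// ltW.
have row i j : \sum_(ab <- [seq (a, b) | a <- iota 0 (2 ^ i), b <- iota 0 (2 ^ j)])
    expected_pairs n l (inl ((i, j), ab)) <= 78 ^+ 4 * L * g (i + j)%N.
  pose m := L / 2 ^+ (i + j).
  apply: (@le_trans _ _ (\sum_(ab <- [seq (a, b) | a <- iota 0 (2 ^ i), b <- iota 0 (2 ^ j)])
      78 ^+ 4 * m ^+ 2 * expR (- m))).
    rewrite big_seq [leRHS]big_seq; apply: ler_sum => _ /allpairsPdep[a [b [ai bj ->]]].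
    by apply: expected_pairs_cell => //; [move: ai|move: bj|rewrite /m LE]; rewrite ?mem_iota.
  rewrite big_const_seq count_predT size_allpairs !size_iota iter_addr addr0 -[leLHS]mulr_natr.
  rewrite natrM !natrX -exprD le_eqVlt; apply/orP; left; apply/eqP.
  have Lm : L = m * 2 ^+ (i + j) by rewrite /m divfK// expf_neq0.
  rewrite /g -/m; clearbody m; rewrite Lm; ring.
apply: (@le_trans _ _ (\sum_(i <- iota 0 n.+1) \sum_(j <- iota 0 n.+1) 78 ^+ 4 * L * g (i + j)%N)).
  by apply: ler_sum => i _; apply: ler_sum => j _; exact: row.
have inner i : \sum_(j <- iota 0 n.+1) 78 ^+ 4 * L * g (i + j)%N <= 78 ^+ 4 * L * 10.
  rewrite -mulr_sumr ler_pM2l; last by rewrite mulr_gt0// exprn_gt0.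
  (* For fixed [i] the values [i + j] form a window of consecutive scales; the missing smaller ones
     have nonnegative terms. *)
  apply: le_trans (sum_scales_le (i + n.+1) kL Lk).
  rewrite big_split_ord -[leLHS]add0r; apply: lerD.
    by apply: sumr_ge0 => s _; exact: g0.
  have -> : iota 0 n.+1 = index_iota 0 n.+1 by rewrite /index_iota subn0.
  by rewrite big_mkord.
apply: (@le_trans _ _ (\sum_(i <- iota 0 n.+1) 78 ^+ 4 * L * 10)).
  by apply: ler_sum => i _; exact: inner.
rewrite big_const_seq count_predT size_iota iter_addr addr0 -[leLHS]mulr_natr.
by rewrite le_eqVlt; apply/orP; left; apply/eqP; rewrite /n; ring.
Qed.

End UpperNumerics.

(** * The lower bound *)

Section Blocks.
Context {R : realType}.
Local Notation E4 := ('rV[R]_4).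
Local Notation pi := (@pi R).
Implicit Types (Y : set E4) (i j a b : nat).

(** The cell [a] with its two neighbours. It contains the interval centred at the midpoint of a pair
    in the outer quarters of the cell and twice as long as the pair, as [close_pair_supporting]
    requires. *)
Definition block i a : set R := [set x | grid i a - width i < x <= grid i a + 2 * width i].

Lemma grid_quarter i a r :
  grid i.+2 (4 * a + r)%N = grid i a + r%:R * (width i / 4) :> R.
Proof.
have w4 : width i = 4 * width i.+2 :> R by rewrite (widthS i) (widthS i.+1); ring.
by rewrite /grid natrD natrM w4 [4 * _ / 4]mulrC mulKf//; ring.
Qed.

Lemma low_quarter i a x : cell i.+2 (4 * a)%N x ->
  grid i a < x /\ x <= grid i a + width i / 4 :> R.
Proof.
have := grid_quarter i a 0; have := grid_quarter i a 1.
by rewrite /cell/= addn1 addn0 => -> -> /andP[? ?]; split; lra.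
Qed.

Lemma high_quarter i a x : cell i.+2 (4 * a + 3)%N x ->
  grid i a + 3 * width i / 4 < x /\ x <= grid i a + width i :> R.
Proof.
have := grid_quarter i a 3; have := grid_quarter i a 4.
by rewrite /cell/= addnS => -> -> /andP[? ?]; split; lra.
Qed.

Lemma low_quarter_block i a : cell i.+2 (4 * a)%N `<=` (block i a : set R).
Proof.
move=> x /low_quarter[x1 x2]; have := width_gt0 (R := R) i => w.
by apply/andP; split; lra.
Qed.

Lemma high_quarter_block i a : cell i.+2 (4 * a + 3)%N `<=` (block i a : set R).
Proof.
move=> x /high_quarter[x1 x2]; have := width_gt0 (R := R) i => w.
by apply/andP; split; lra.
Qed.

Lemma block_sub_circle i a : (0 < a)%N -> (a.+2 <= 2 ^ i)%N -> block i a `<=` @circle R.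
Proof.
move=> a0 ai x /andP[x1 x2]; rewrite /circle/= in_itv/=.
have h1 : - pi <= grid i a - width i :> R.
  by rewrite -(grid0 i); case: a a0 {ai x1 x2} => // a _; rewrite gridS addrK grid_le.
have h2 : grid i a + 2 * width i <= pi :> R.
  have -> : grid i a + 2 * width i = grid i a.+2 :> R by rewrite !gridS; ring.
  by rewrite -(grid_max i) grid_le.
by apply/andP; split; lra.
Qed.

Lemma measurable_block i a : measurable (block i a : set R).
Proof.
have -> : block i a = `]grid i a - width i, grid i a + 2 * width i]%classic :> set R.
  by apply/seteqP; split=> x; rewrite /block/= in_itv.
exact: measurable_itv.
Qed.

Lemma leb_block i a : (lebesgue_measure (block i a : set R) <= (3 * width i)%:E)%E.
Proof.
have -> : block i a = `]grid i a - width i, grid i a + 2 * width i]%classic :> set R.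
  by apply/seteqP; split=> x; rewrite /block/= in_itv.
have w := width_gt0 (R := R) i.
rewrite lebesgue_measure_itv /= lte_fin ifT; last by lra.
by rewrite lee_fin; lra.
Qed.

(** Opposite corners of the cell, with sides a quarter of its sides. Points in opposite quarters are
    more than half a width and less than a width apart, which ties the pair to its scale. *)
Definition low_square i j a b : set (R * R) := cell i.+2 (4 * a)%N `*` cell j.+2 (4 * b)%N.
Definition high_square i j a b : set (R * R) :=
  cell i.+2 (4 * a + 3)%N `*` cell j.+2 (4 * b + 3)%N.
Definition block_square i j a b : set (R * R) := block i a `*` block j b.

Definition isolated_pair Y i j a b (t t' : R * R) :=
  [/\ low_square i j a b t, high_square i j a b t', Y (clifford_map t), Y (clifford_map t') &
    forall s, Y (clifford_map s) -> block_square i j a b s -> s = t \/ s = t'].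

Lemma isolated_pair_supporting Y i j a b t t' :
  Y `<=` clifford_torus -> (2 <= i)%N -> (2 <= j)%N -> (0 < a)%N -> (0 < b)%N ->
  (a.+2 <= 2 ^ i)%N -> (b.+2 <= 2 ^ j)%N -> isolated_pair Y i j a b t t' ->
  exists u c, [/\ Y `<=` [set x | dot u x <= c],
    dot u (clifford_map t) = c, dot u (clifford_map t') = c &
    forall x, Y x -> dot u x = c -> x = clifford_map t \/ x = clifford_map t'].
Proof.
move=> YT i2 j2 a0 b0 ai bj [[t1 t2] [t1' t2'] Yt Yt' H].
have wle h : (2 <= h)%N -> width h <= pi / 2 :> R.
  move=> h2; rewrite /width ler_pdivrMr ?exprn_gt0//.
  have : 2 ^+ 2 <= 2 ^+ h :> R by apply: ler_weXn2l => //; lra.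
  by have := pi_gt0 R; nra.
have bound h c (x x' : R) : (2 <= h)%N -> (0 < c)%N -> (c.+2 <= 2 ^ h)%N ->
    cell h.+2 (4 * c)%N x -> cell h.+2 (4 * c + 3)%N x' ->
    [/\ 0 < x' - x <= pi / 2, - pi < (x + x') / 2 - (x' - x),
       (x + x') / 2 + (x' - x) <= pi &
       forall y, `|y - (x + x') / 2| <= x' - x -> block h c y].
  move=> h2 c0 ch /low_quarter[x1 x2] /high_quarter[x1' x2'].
  have w := width_gt0 (R := R) h; have wpi := wle h h2.
  have l1 : - pi <= grid h c - width h.
    by rewrite -(grid0 h); case: c c0 {ch x1 x2 x1' x2'} => // c _; rewrite gridS addrK grid_le.
  have l2 : grid h c + 2 * width h <= pi.
    have -> : grid h c + 2 * width h = grid h c.+2 :> R by rewrite !gridS; ring.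
    by rewrite -(grid_max h) grid_le.
  split.
  - by apply/andP; split; lra.
  - lra.
  - lra.
  - move=> y; rewrite ler_norml => /andP[y1 y2].
    by apply/andP; split; lra.
have [p1 p2 p3 p4] := bound _ _ _ _ i2 a0 ai t1 t1'.
have [q1 q2 q3 q4] := bound _ _ _ _ j2 b0 bj t2 t2'.
apply: close_pair_supporting => // s _ Ys s1 s2.
by apply: H => //; split; [exact: p4|exact: q4].
Qed.

(** The extent of the pair in the first angle lies between [width i / 2] and [width i]. These ranges
    are disjoint for different [i], so [i] is determined; [j] follows from the fixed sum, and then
    [a] and [b] because cells are disjoint. *)
Lemma isolated_pair_inj Y i j a b t t' i' j' a' b' s s' :
  isolated_pair Y i j a b t t' -> isolated_pair Y i' j' a' b' s s' ->
  (i + j = i' + j')%N ->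
  t = s -> t' = s' -> [/\ i = i', a = a' & b = b'].
Proof.
move=> [[t1 t2] [t1' t2'] _ _ _] [[s1 s2] [s1' s2'] _ _ _] ij ts ts'.
rewrite -{s}ts -{s'}ts' in s1 s2 s1' s2'.
have wmono h h' : (h < h')%N -> 2 * width h' <= width h :> R.
  elim: h' => // h' IH; rewrite ltnS leq_eqVlt => /orP[/eqP->|/IH].
    by rewrite -widthS.
  by rewrite -widthS; have := width_gt0 (R := R) h'; lra.
have no h h' c c' (x x' : R) : cell h.+2 (4 * c)%N x -> cell h.+2 (4 * c + 3)%N x' ->
    cell h'.+2 (4 * c')%N x -> cell h'.+2 (4 * c' + 3)%N x' -> ~~ (h < h')%N.
  move=> /low_quarter[x1 x2] /high_quarter[x1' x2'] /low_quarter[y1 y2] /high_quarter[y1' y2'].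
  by apply/negP => /wmono; lra.
have ii' : i = i'.
  apply/eqP; rewrite eqn_leq; apply/andP; split; rewrite leqNgt.
    exact: (no i' i a' a t.1 t'.1).
  exact: (no i i' a a' t.1 t'.1).
have jj' : j = j' by move: ij; rewrite ii' => /addnI.
rewrite -ii' in s1; rewrite -jj' in s2.
have a4 : (4 * a = 4 * a')%N := cell_uniq t1 s1.
have b4 : (4 * b = 4 * b')%N := cell_uniq t2 s2.
by split=> //; lia.
Qed.

(** This orders the two endpoints, so that equality of unordered pairs yields equality of ordered
    ones. *)
Lemma isolated_pair_lt Y i j a b t t' : isolated_pair Y i j a b t t' -> t.1 < t'.1.
Proof.
move=> [[/low_quarter[t1 t2] _] [/high_quarter[t1' t2'] _] _ _ _].
by have := width_gt0 (R := R) i; lra.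
Qed.

End Blocks.

(** * Edges spanned by isolated pairs *)

Section LowerBound.
Context {R : realType}.
Local Notation E4 := ('rV[R]_4).
Local Notation pi := (@pi R).

Section BlockIndices.
Variable q : nat.

(* The index (i, c) encodes a scale i and, through the quotient and the remainder
   of c, a cell of the grid of scale (i + 2, q + 1 - i) away from its boundary. *)
Definition block_index := ('I_q * 'I_(2 ^ q.+1))%type.
Implicit Type x : block_index.

Definition scale1 x : nat := (x.1 : nat).+2.
Definition scale2 x : nat := (q.+1 - x.1)%N.
Definition block_col x : nat := (x.2 %% 2 ^ (x.1 : nat).+1).+1.
Definition block_row x : nat := (x.2 %/ 2 ^ (x.1 : nat).+1).+1.

Lemma scale_sum x : (scale1 x + scale2 x = q.+3)%N.
Proof. by rewrite /scale1 /scale2; have := ltn_ord x.1; lia. Qed.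

Lemma scale2_ge2 x : (2 <= scale2 x)%N.
Proof. by rewrite /scale2; have := ltn_ord x.1; lia. Qed.

Lemma col_lt x : ((block_col x).+2 <= 2 ^ scale1 x)%N.
Proof.
have := ltn_pmod x.2 (expn_gt0 2 (x.1 : nat).+1).
rewrite /block_col /scale1 (expnS 2 (x.1 : nat).+1); have : (2 <= 2 ^ (x.1 : nat).+1)%N.
  by rewrite -{1}(expn1 2) leq_exp2l.
by set m := (2 ^ _)%N; lia.
Qed.

Lemma row_lt x : ((block_row x).+2 <= 2 ^ scale2 x)%N.
Proof.
have x1 := ltn_ord x.1.
have : (x.2 %/ 2 ^ (x.1 : nat).+1 < 2 ^ (q - x.1))%N.
  rewrite ltn_divLR ?expn_gt0// -expnD.
  by have -> : (q - x.1 + (x.1 : nat).+1 = q.+1)%N by lia.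
have -> : scale2 x = (q - x.1).+1 by rewrite /scale2; lia.
rewrite /block_row (expnS 2 (q - x.1)); have : (2 <= 2 ^ (q - x.1))%N.
  by rewrite -{1}(expn1 2) leq_exp2l//; lia.
by move: (2 ^ (q - x.1))%N (_ %/ _)%N => m e; lia.
Qed.

Lemma block_index_inj x y :
  scale1 x = scale1 y -> block_col x = block_col y -> block_row x = block_row y -> x = y.
Proof.
case: x y => [i c] [i' c']; rewrite /scale1 /block_col /block_row /= => -[/val_inj ii'].
rewrite -ii' => -[cm] [cd]; rewrite ii'; congr pair; apply: val_inj => /=.
by rewrite (divn_eq c (2 ^ i.+1)) cm cd -divn_eq.
Qed.

End BlockIndices.

Variable q : nat.
Implicit Types (Y : set E4) (x : block_index q).

Definition low_region x : set (R * R) := low_square (scale1 x) (scale2 x) (block_col x) (block_row x).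
Definition high_region x : set (R * R) := high_square (scale1 x) (scale2 x) (block_col x) (block_row x).
Definition block_region x : set (R * R) := block_square (scale1 x) (scale2 x) (block_col x) (block_row x).
Definition gap_region x := block_region x `\` (low_region x `|` high_region x).
Definition outer_region x := @angle_square R `\` block_region x.

(** A partition of the whole torus. The outer region is included so that one event, with independent
    factors, also fixes the total number of points. *)
Definition part x (i : 'I_4) : set (R * R) :=
  nth set0 [:: low_region x; high_region x; gap_region x; outer_region x] i.

Lemma block_region_sub x : block_region x `<=` angle_square.
Proof.
move=> t [t1 t2]; split.
  by apply: block_sub_circle t1 => //; exact: col_lt.
by apply: block_sub_circle t2 => //; exact: row_lt.
Qed.

Lemma low_region_sub x : low_region x `<=` block_region x.
Proof. by move=> t [t1 t2]; split; exact: low_quarter_block. Qed.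

Lemma high_region_sub x : high_region x `<=` block_region x.
Proof. by move=> t [t1 t2]; split; exact: high_quarter_block. Qed.

Lemma low_high_disjoint x : low_region x `&` high_region x = set0.
Proof.
apply/seteqP; split=> // t [[/low_quarter[t1 t2] _] [/high_quarter[t1' t2'] _]].
by have := width_gt0 (R := R) (scale1 x); lra.
Qed.

Lemma torus_measurable_block x : torus_measurable (block_region x).
Proof.
split; last exact: block_region_sub.
by apply: measurableX; exact: measurable_block.
Qed.

Lemma torus_measurable_low x : torus_measurable (low_region x).
Proof.
split; last by move=> t /low_region_sub/block_region_sub.
by apply: measurableX; exact: measurable_cell.
Qed.

Lemma torus_measurable_high x : torus_measurable (high_region x).
Proof.
split; last by move=> t /high_region_sub/block_region_sub.
by apply: measurableX; exact: measurable_cell.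
Qed.

Lemma torus_measurable_part x i : torus_measurable (part x i).
Proof.
have h1 := torus_measurable_low x; have h2 := torus_measurable_high x.
case: i => -[|[|[|[|//]]]] hi //; rewrite /part /=.
  apply: torus_measurableD; first exact: torus_measurable_block.
  split; first by apply: measurableU; [exact: h1.1|exact: h2.1].
  by move=> t [/h1.2|/h2.2].
by apply: torus_measurableD; [exact: torus_measurable_square|exact: torus_measurable_block].
Qed.

Lemma part_disjoint x : trivIset setT (part x).
Proof.
have d12 := low_high_disjoint x.
have d13 : low_region x `&` gap_region x = set0.
  by apply/seteqP; split=> // t [h [_]]; apply; left.
have d23 : high_region x `&` gap_region x = set0.
  by apply/seteqP; split=> // t [h [_]]; apply; right.
have d14 : low_region x `&` outer_region x = set0.
  by apply/seteqP; split=> // t [/low_region_sub h [_]]; apply.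
have d24 : high_region x `&` outer_region x = set0.
  by apply/seteqP; split=> // t [/high_region_sub h [_]]; apply.
have d34 : gap_region x `&` outer_region x = set0.
  by apply/seteqP; split=> // t [[h _] [_]]; apply.
apply/trivIsetP => -[[|[|[|[|//]]]] hi] [[|[|[|[|//]]]] hj] _ _; rewrite /part //=;
  by rewrite setIC.
Qed.

Lemma part_cover x : angle_square `<=` \bigcup_i part x i.
Proof.
move=> t sqt.
have [tb|tb] := pselect (block_region x t); last by exists (@Ordinal 4 3 isT).
have [t1|t1] := pselect (low_region x t); first by exists (@Ordinal 4 0 isT).
have [t2|t2] := pselect (high_region x t); first by exists (@Ordinal 4 1 isT).
by exists (@Ordinal 4 2 isT) => //; split=> // -[].
Qed.

Definition ncounts (r : nat) (i : 'I_4) : nat := nth 0%N [:: 1; 1; 0; r]%N i.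

Lemma isolated_pair_exists Y x r : finite_set Y -> Y `<=` clifford_torus ->
  (forall i, #|` fset_set (Y `&` clifford_map @` (part x i))| = ncounts r i) ->
  (#|` fset_set Y| <= r.+2)%N /\
  exists tt : (R * R) * (R * R),
    isolated_pair Y (scale1 x) (scale2 x) (block_col x) (block_row x) tt.1 tt.2.
Proof.
move=> fY YT H.
pose F i := Y `&` clifford_map @` (part x i).
have fF i : finite_set (F i) by exact: finite_setIl.
split.
  have YF : Y `<=` \bigcup_(i in [set` index_enum 'I_4]) F i.
    move=> y Yy; have [t sqt ty] := YT _ Yy; have [i _ pt] := part_cover x sqt.
    by exists i; [rewrite /= mem_index_enum|split=> //; exists t].
  have [fU le] := card_bigcup_le (index_enum 'I_4) fF.
  have -> : r.+2 = (\sum_(i < 4) #|` fset_set (F i)|)%N.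
    by under eq_bigr do rewrite H; rewrite !big_ord_recl big_ord0 /ncounts /= !add1n add0n addn0.
  apply: leq_trans le; apply: fsubset_leq_card; rewrite -fset_set_sub//.
have one i : #|` fset_set (F i)| = 1%N -> exists2 t, part x i t & F i = [set clifford_map t].
  move=> /eqP/cardfs1P[y Fy]; have FE : F i = [set y].
    by rewrite -(fset_setK (fF i)) Fy; apply/seteqP; split=> z /=; rewrite inE => /eqP.
  have [Yy [t pt ty]] : F i y by rewrite FE.
  by exists t => //; rewrite FE ty.
have [t lt Ft] := one _ (H (@Ordinal 4 0 isT)).
have [t' ht' Ft'] := one _ (H (@Ordinal 4 1 isT)).
have F0 : F (@Ordinal 4 2 isT) = set0.
  by apply: fset_set_set0 => //; apply/eqP; rewrite -cardfs_eq0; apply/eqP; exact: H.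
have sqt := (torus_measurable_low x).2 _ lt.
have sqt' := (torus_measurable_high x).2 _ ht'.
exists (t, t'); split=> //=.
- by have [] : F (@Ordinal 4 0 isT) (clifford_map t) by rewrite Ft.
- by have [] : F (@Ordinal 4 1 isT) (clifford_map t') by rewrite Ft'.
- move=> s Ys bs; have sqs := block_region_sub bs.
  have [t1|t1] := pselect (low_region x s).
    left; apply: clifford_map_inj => //.
    suff : F (@Ordinal 4 0 isT) (clifford_map s) by rewrite Ft.
    by split=> //; exists s.
  have [t2|t2] := pselect (high_region x s).
    right; apply: clifford_map_inj => //.
    suff : F (@Ordinal 4 1 isT) (clifford_map s) by rewrite Ft'.
    by split=> //; exists s.
  exfalso; suff : F (@Ordinal 4 2 isT) (clifford_map s) by rewrite F0.
  by split=> //; exists s => //; split=> // -[].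
Qed.

(** Every index of [B] gives an edge of its own, and any single one bounds the number of vertices:
    two in the corners and at most [M] outside the block. *)
Lemma mean_valence_ge Y (M : nat) (B : {set block_index q}) :
  finite_set Y -> Y `<=` clifford_torus ->
  (forall x, x \in B -> exists2 r, (r <= M)%N &
     forall i, #|` fset_set (Y `&` clifford_map @` (part x i))| = ncounts r i) ->
  2 / M.+2%:R * #|B|%:R <= mean_valence (convex_hull Y).
Proof.
move=> fY YT H.
have YS : forall y : E4, Y y -> dot y y = 2 by move=> y /YT; exact: clifford_torus_sphere.
have [B0|[x0 x0B]] := set_0Vmem B.
  by rewrite B0 cards0 mulr0 mean_valence_ge0.
have ex x : exists tt : (R * R) * (R * R), x \in B ->
    isolated_pair Y (scale1 x) (scale2 x) (block_col x) (block_row x) tt.1 tt.2.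
  have [xB|xB] := boolP (x \in B); last by exists (0, 0, (0, 0)).
  have [r rM Hr] := H _ xB; have [_ [tt Htt]] := isolated_pair_exists fY YT Hr.
  by exists tt.
have [f Hf] := choice ex.
have sq x : x \in B -> angle_square (f x).1 /\ angle_square (f x).2.
  move=> /Hf[h1 h2 _ _ _]; split.
    exact: (torus_measurable_low x).2.
  exact: (torus_measurable_high x).2.
have f1 : (#|B| <= face_number (convex_hull Y) 1)%N.
  apply: (@face_number1_ge _ Y fY _ B (fun x => clifford_map (f x).1)
      (fun x => clifford_map (f x).2)).
    move=> x xB; have ip := Hf x xB; have [_ _ Yt Yt' _] := ip.
    have [sq1 sq2] := sq x xB; split=> //.
      by apply/eqP => /clifford_map_inj => /(_ sq1 sq2) e; have := isolated_pair_lt ip; rewrite e ltxx.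
    by apply: isolated_pair_supporting ip => //;
      [exact: scale2_ge2|exact: col_lt|exact: row_lt].
  move=> x y xB yB e; have ipx := Hf x xB; have ipy := Hf y yB.
  have [sx1 sx2] := sq x xB; have [sy1 sy2] := sq y yB.
  have ltx := isolated_pair_lt ipx; have lty := isolated_pair_lt ipy.
  have m1 : (f x).1 = (f y).1 \/ (f x).1 = (f y).2.
    have : [set clifford_map (f y).1; clifford_map (f y).2] (clifford_map (f x).1).
      by rewrite -e; left.
    by case=> /clifford_map_inj h; [left; exact: h|right; exact: h].
  have m2 : (f x).2 = (f y).1 \/ (f x).2 = (f y).2.
    have : [set clifford_map (f y).1; clifford_map (f y).2] (clifford_map (f x).2).
      by rewrite -e; right.
    by case=> /clifford_map_inj h; [left; exact: h|right; exact: h].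
  (* The crossed matchings are excluded because in both pairs the first angle increases. *)
  have [e1 e2] : (f x).1 = (f y).1 /\ (f x).2 = (f y).2.
    case: m1 m2 => e1 [] e2 //; exfalso; move: ltx; rewrite e1 e2 ?ltxx//.
    by move=> /(lt_trans lty); rewrite ltxx.
  have [] := isolated_pair_inj ipx ipy _ e1 e2; first by rewrite !scale_sum.
  exact: block_index_inj.
have [r0 r0M Hr0] := H _ x0B.
have [nle _] := isolated_pair_exists fY YT Hr0.
have [_ _ Yt _ _] := Hf x0 x0B.
have n0 : (0 < #|` fset_set Y|)%N.
  by rewrite cardfs_gt0; apply/fset0Pn; exists (clifford_map (f x0).1); rewrite in_fset_set// inE.
rewrite /mean_valence (face_number0 fY YS) gtn_eqF//.
have nR : 0 < #|` fset_set Y|%:R :> R by rewrite ltr0n.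
rewrite mulrAC; apply: ler_pM.
- by rewrite mulr_ge0.
- by rewrite invr_ge0.
- by rewrite ler_pM2l// ler_nat.
- by rewrite lef_pV2 ?posrE// ler_nat (leq_trans nle).
Qed.

End LowerBound.

(** * Probability of an isolated pair *)

Section ExpectedLowerBound.
Context {R : realType} d (Omega : measurableType d) (P : probability Omega R).
Local Notation pi := (@pi R).
Variables (l : R) (X : Omega -> set 'rV[R]_4).
Hypotheses (l0 : 0 < l) (hX : clifford_poisson_process P l X).
Variable q : nat.
Implicit Types (x : block_index q) (r : nat).

Definition pair_event x r := \bigcap_i cnt X (part x i) (ncounts r i).

Lemma measurable_pair_event x r : measurable (pair_event x r).
Proof.
apply: fin_bigcap_measurable; first exact: finite_finset.
by move=> i _; apply: (measurable_cnt hX); exact: torus_measurable_part.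
Qed.

Definition pair_prob x r : R :=
  pois (l * area (low_region x)) 1 * (pois (l * area (high_region x)) 1 *
    (pois (l * area (gap_region x)) 0 * pois (l * area (outer_region x)) r)).

Lemma P_pair_event x r : P (pair_event x r) = (pair_prob x r)%:E.
Proof.
rewrite (P_cnt_indep l0 hX); last exact: part_disjoint.
  by rewrite !big_ord_recl big_ord0 /part /ncounts /pair_prob /= mulr1.
exact: torus_measurable_part.
Qed.

Lemma pair_event_finite x r w : pair_event x r w -> finite_set (X w).
Proof.
move=> H; have [XT _ _] := hX.
apply: (@sub_finite_set _ _ (\bigcup_i (X w `&` clifford_map @` (part x i)))).
  move=> y Xy; have [t sqt ty] := XT _ _ Xy; have [i _ pt] := part_cover x sqt.
  by exists i => //; split=> //; exists t.
apply: bigcup_finite; first exact: finite_finset.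
by move=> i _; apply/finite_setP; exists (ncounts r i); exact: H.
Qed.

(** For a fixed [x] the events for different [r] exclude each other, as they prescribe different
    outer counts, so the inner sum is an indicator. If [X w] is infinite all these events fail. *)
Lemma valence_pointwise_ge M w :
  2 / M.+2%:R * (\sum_x \sum_(r < M.+1) \1_(pair_event x r) w) <=
    mean_valence (convex_hull (X w)).
Proof.
have [XT _ _] := hX.
have [fX|nX] := pselect (finite_set (X w)); last first.
  rewrite big1 ?mulr0 ?mean_valence_ge0// => x _; rewrite big1// => r _.
  by rewrite indicE memNset// => /pair_event_finite.
pose B : {set block_index q} := [set x | `[< exists2 r, (r <= M)%N & pair_event x r w >]]%SET.
apply: (@le_trans _ _ (2 / M.+2%:R * #|B|%:R)).
  rewrite ler_pM2l; last by rewrite divr_gt0.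
  rewrite -sum1_card natr_sum [leRHS]big_mkcond/=; apply: ler_sum => x _.
  rewrite !inE; case: asboolP => [[r rM Hr]|H]; last first.
    rewrite big1// => r _; rewrite indicE memNset// => Hr; apply: H.
    by exists r => //; rewrite -ltnS.
  rewrite (bigD1 (Ordinal (rM : (r < M.+1)%N)))//= big1 => [|r' rr'].
    by rewrite addr0 indicE; case: (_ \in _).
  rewrite indicE memNset// => Hr'; move/eqP: rr'; apply; apply: val_inj => /=.
  pose i3 := @Ordinal 4 3 isT.
  have e' : ncount X w (part x i3) = r' := (cntP _ _ fX).1 (Hr' i3 I).
  have e : ncount X w (part x i3) = r := (cntP _ _ fX).1 (Hr i3 I).
  by rewrite -e' -e.
apply: mean_valence_ge => // x; rewrite inE => /asboolP[r rM Hr].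
by exists r => // i; exact/(cntP _ _ fX)/Hr.
Qed.

Lemma expected_valence_ge_sum M :
  ((2 / M.+2%:R * \sum_x \sum_(r < M.+1) pair_prob x r)%:E <=
   \int[P]_w (mean_valence (convex_hull (X w)))%:E)%E.
Proof.
pose g x r w : \bar R := (\1_(pair_event x r) w)%:E.
have mg x r : measurable_fun setT (g x r).
  by apply/measurable_EFinP; apply: measurable_indic; exact: measurable_pair_event.
have g0 x r w : (0 <= g x r w)%E by rewrite lee_fin.
pose h x w := (\sum_(r < M.+1) g x r w)%E.
have mh x : measurable_fun setT (h x) by apply: emeasurable_sum => r; exact: mg.
have h0 x w : (0 <= h x w)%E by exact: sume_ge0.
have ms : measurable_fun setT (fun w => (\sum_x h x w)%E) by exact: emeasurable_sum.
have s0 w : (0 <= \sum_x h x w)%E by exact: sume_ge0.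
have M0 : 0 <= 2 / M.+2%:R :> R by rewrite divr_ge0.
apply: (@le_trans _ _ (\int[P]_w ((2 / M.+2%:R)%:E * \sum_x h x w)%E)%E); last first.
  apply: le_integral_nonmeasurable => w; first by rewrite mule_ge0// lee_fin.
  apply: (@le_trans _ _ (2 / M.+2%:R * (\sum_x \sum_(r < M.+1) \1_(pair_event x r) w))%:E).
    rewrite [leRHS]EFinM -sumEFin; apply: lee_wpmul2l; first by rewrite lee_fin.
    by apply: lee_sum => x _; rewrite -sumEFin.
  by rewrite lee_fin; exact: valence_pointwise_ge.
rewrite (ge0_integralZl_EFin _ measurableT _ ms)//.
rewrite ge0_integral_sum// [in leLHS]EFinM -sumEFin.
apply: lee_wpmul2l; first by rewrite lee_fin.
apply: lee_sum => x _; rewrite ge0_integral_sum// -sumEFin.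
apply: lee_sum => r _; rewrite integral_indic ?setIT//; last exact: measurable_pair_event.
by have := P_pair_event x r => <-.
Qed.

(** The mean [m] of a cell lies between 1 and 2. Each corner has mean [m / 16] and holds one point
    with probability at least [expR (- 1) / 16]; the gap has mean at most [9 * m <= 18]; the outer
    count is at most [M] with probability at least [1 / 2]. The product of these bounds is
    [expR (- 20) / 2 ^+ 9], for each of [q * 2 ^ q.+1] indices. *)
Lemma expected_valence_ge L : L = l * (2 * pi) ^+ 2 -> 2 ^+ q.+3 <= L -> L < 2 ^+ q.+4 ->
  ((q%:R * (expR (- 20) / 2 ^+ 13))%:E <= \int[P]_w (mean_valence (convex_hull (X w)))%:E)%E.
Proof.
move=> LE qL Lq.
have L0 : 0 < L by apply: lt_le_trans qL; rewrite exprn_gt0.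
(* At least twice the mean [L] of the total count, as [pois_head_ge] requires. *)
pose M := (2 ^ q.+4.+1)%N.
have MR : M%:R = 2 ^+ q.+4.+1 :> R by rewrite natrX.
apply: le_trans (expected_valence_ge_sum M); rewrite lee_fin.
have term x : expR (- 20) / 2 ^+ 9 <= \sum_(r < M.+1) pair_prob x r.
  have ww : l * (width (scale1 x) * width (scale2 x)) = L / 2 ^+ q.+3.
    by rewrite LE /width -(scale_sum x) exprD; field; rewrite !expf_neq0.
  have m1 : 1 <= L / 2 ^+ q.+3 by rewrite ler_pdivlMr ?exprn_gt0// mul1r.
  have m2 : L / 2 ^+ q.+3 <= 2.
    by rewrite ler_pdivrMr ?exprn_gt0// -exprS ltW.
  set m := L / 2 ^+ q.+3 in ww m1 m2.
  have quarter i : width i.+2 = width i / 4 :> R.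
    by rewrite (widthS i) (widthS i.+1); field.
  have a1 : l * area (low_region x) = m / 16.
    rewrite (areaX (a := width (scale1 x).+2) (b := width (scale2 x).+2)) ?leb_cell//;
      try exact: measurable_cell.
    by rewrite (quarter (scale1 x)) (quarter (scale2 x)) -ww; field.
  have a2 : l * area (high_region x) = m / 16.
    rewrite (areaX (a := width (scale1 x).+2) (b := width (scale2 x).+2)) ?leb_cell//;
      try exact: measurable_cell.
    by rewrite (quarter (scale1 x)) (quarter (scale2 x)) -ww; field.
  have a3 : l * area (gap_region x) <= 18.
    apply: (@le_trans _ _ (9 * m)); last by lra.
    rewrite -ww mulrCA ler_pM2l//.
    apply: (@le_trans _ _ (area (block_region x))).
      apply: area_le; [exact: (torus_measurable_part x (@Ordinal 4 2 isT))|
        exact: torus_measurable_block|by move=> t []].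
    have -> : 9 * (width (scale1 x) * width (scale2 x)) =
        (3 * width (scale1 x)) * (3 * width (scale2 x)) :> R by ring.
    by apply: areaX_le; [exact: measurable_block|exact: measurable_block|
      exact: leb_block|exact: leb_block].
  have a4 : l * area (outer_region x) <= L.
    rewrite LE -area_square ler_pM2l//; apply: area_le.
    - exact: (torus_measurable_part x (@Ordinal 4 3 isT)).
    - exact: torus_measurable_square.
    - by move=> t [].
  have a40 : 0 <= l * area (outer_region x) by rewrite mulr_ge0 ?area_ge0// ltW.
  rewrite /pair_prob -!mulr_sumr a1 a2 pois1 pois0.
  have p1 : expR (- 1) / 16 <= expR (- (m / 16)) * (m / 16).
    apply: ler_pM; rewrite ?expR_ge0//; last by lra.
    by rewrite ler_expR; lra.
  have p3 : expR (- 18) <= expR (- (l * area (gap_region x))).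
    by rewrite ler_expR lerN2.
  have p4 : 1 / 2 <= \sum_(r < M.+1) pois (l * area (outer_region x)) r.
    apply: pois_head_ge => //; rewrite -[leRHS]natr1 MR.
    by move: Lq; rewrite !exprS; lra.
  have e0 : 0 <= expR (- 1) / 16 :> R by rewrite divr_ge0 ?expR_ge0.
  have -> : expR (- 20) / 2 ^+ 9 = expR (- 1) / 16 * (expR (- 1) / 16 * (expR (- 18) * (1 / 2))) :> R.
    have -> : - 20 = - 1 + (- 1 + - 18) :> R by ring.
    by rewrite !expRD; field.
  have f0 : 0 <= expR (- 18) * (1 / 2) :> R by rewrite mulr_ge0 ?expR_ge0.
  have f1 : expR (- 18) * (1 / 2) <= expR (- (l * area (gap_region x))) *
      \sum_(r < M.+1) pois (l * area (outer_region x)) r.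
    by apply: ler_pM => //; rewrite expR_ge0.
  by apply: ler_pM => //; apply: ler_pM.
have sum_ge : q%:R * 2 ^+ q.+1 * (expR (- 20) / 2 ^+ 9) <= \sum_x \sum_(r < M.+1) pair_prob x r.
  apply: (@le_trans _ _ (\sum_(x : block_index q) (expR (- 20) / 2 ^+ 9))).
    rewrite sumr_const -[leRHS]mulr_natl card_prod !card_ord natrM natrX.
    by [].
  by apply: ler_sum => x _; exact: term.
apply: (@le_trans _ _ (2 / M.+2%:R * (q%:R * 2 ^+ q.+1 * (expR (- 20) / 2 ^+ 9)))); last first.
  by rewrite ler_pM2l// divr_gt0.
have M2 : M.+2%:R <= 2 ^+ q.+4.+2 :> R.
  have -> : M.+2%:R = M%:R + 2 :> R by rewrite -addn2 natrD.
  rewrite MR; have : 2 ^+ 1 <= 2 ^+ q.+4.+1 :> R by apply: ler_weXn2l => //; lra.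
  by rewrite expr1 (exprS _ q.+4.+1); lra.
have c0 : 0 <= q%:R * 2 ^+ q.+1 * (expR (- 20) / 2 ^+ 9) :> R.
  by apply: mulr_ge0; [apply: mulr_ge0; rewrite ?exprn_ge0|apply: divr_ge0; rewrite ?expR_ge0 ?exprn_ge0].
(* The powers of two combine as [2 * 2 ^ (q + 1) / 2 ^ (q + 6) = 2 ^ (- 4)], which turns [2 ^+ 9]
   into [2 ^+ 13]. *)
apply: (@le_trans _ _ (2 / 2 ^+ q.+4.+2 * (q%:R * 2 ^+ q.+1 * (expR (- 20) / 2 ^+ 9)))).
  rewrite le_eqVlt; apply/orP; left; apply/eqP.
  have -> : 2 ^+ q.+4.+2 = 32 * 2 ^+ q.+1 :> R by rewrite !exprS; ring.
  have : 2 ^+ q.+1 != 0 :> R by rewrite expf_neq0.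
  move: (2 ^+ q.+1) => z z0; field.
  by [].
by rewrite ler_wpM2r// ler_pM2l// lef_pV2 ?posrE ?exprn_gt0.
Qed.

End ExpectedLowerBound.

(** * Comparison with the logarithm of the rate *)

Section Final.
Context {R : realType}.
Local Notation pi := (@pi R).

Lemma pow2_bracket (L : R) : 1 <= L -> exists2 k, 2 ^+ k <= L & L < 2 ^+ k.+1.
Proof.
move=> L1.
have ex : exists n, L < 2 ^+ n.
  exists (Num.truncn L).+1; have /andP[_ h] := Num.Theory.truncn_itv (le_trans ler01 L1).
  by apply: (lt_le_trans h); rewrite -natrX ler_nat ltnW// ltn_expl.
case: (ex_minnP ex) => -[|k] kL min; first by move: kL; rewrite expr0; lra.
exists k => //; rewrite leNgt; apply/negP => /min; by rewrite ltnn.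
Qed.

(** The threshold [K] is the integer part of [L / 4], a quarter of the mean number of points. Then
    [2 / K.+1 * L <= 8], which yields the factor 8, while the event of at most [K] points
    contributes at most [L / 2 * expR (- (L / 4)) <= 2]. *)
Lemma expected_valence_le_scale d (Omega : measurableType d) (P : probability Omega R)
    (l : R) (X : Omega -> set 'rV[R]_4) (L : R) k :
  0 < l -> clifford_poisson_process P l X ->
  L = l * (2 * pi) ^+ 2 -> 12 <= L -> 2 ^+ k <= L -> L < 2 ^+ k.+1 ->
  (\int[P]_w (mean_valence (convex_hull (X w)))%:E <=
   (8 * (10 * 78 ^+ 4 * k.+2%:R + 2 * 78 ^+ 2) + 2)%:E)%E.
Proof.
move=> l0 hX LE L12 kL Lk.
have L0 : 0 < L by lra.
have L4 : 0 <= L / 4 by lra.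
have /andP[K1 K2] := Num.Theory.truncn_itv L4.
set K := Num.truncn (L / 4) in K1 K2.
have K3 : (2 <= K)%N.
  rewrite -ltnS -(ltr_nat R); apply: le_lt_trans K2; lra.
apply: le_trans (expected_valence_le l0 hX k.+1 K3) _; rewrite lee_fin area_square -LE.
apply: lerD.
  set C := (X in 8 * X).
  have C0 : 0 <= C by rewrite addr_ge0// mulr_ge0// ?exprn_ge0// mulr_ge0// exprn_ge0.
  have S : \sum_(x <- region_indices k.+1) expected_pairs k.+1 l x <= L * C.
    exact: expected_pairs_sum LE kL Lk.
  apply: (@le_trans _ _ (2 / K.+1%:R * (L * C))); first by rewrite ler_pM2l// divr_gt0.
  rewrite mulrA ler_wpM2r// mulrAC ler_pdivrMr ?ltr0n//; lra.
apply: (@le_trans _ _ (2 * K%:R * (2 ^+ K * expR (- (L / 2))))).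
  by rewrite ler_wpM2l ?mulr_ge0// pois_head_le// ltW.
(* From [2 <= expR 1]; this absorbs the factor [2 ^+ K] of the Chernoff bound into half of its
   exponential. *)
have e2 : 2 ^+ K <= expR (L / 4).
  apply: (@le_trans _ _ (expR 1 ^+ K)).
    by apply: lerXn2r; rewrite ?nnegrE ?expR_ge0//; have := expR_ge1Dx (1 : R); lra.
  by rewrite -expRM_natr mul1r ler_expR.
apply: (@le_trans _ _ (L / 2 * expR (- (L / 4)))).
  have -> : L / 2 * expR (- (L / 4)) = L / 2 * (expR (L / 4) * expR (- (L / 2))).
    by rewrite -expRD; congr (_ * expR _); field.
  apply: ler_pM; rewrite ?mulr_ge0 ?exprn_ge0 ?expR_ge0//; first by lra.
  by rewrite ler_wpM2r ?expR_ge0.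
apply: (@le_trans _ _ (L / 2 * (L / 4)^-1)).
  by rewrite ler_pM2l ?divr_gt0// expRN_le_inv// divr_gt0.
by rewrite le_eqVlt; apply/orP; left; apply/eqP; field; rewrite gt_eqF.
Qed.

End Final.

(** The upper limit is an infimum of suprema over neighbourhoods of infinity, so the single
    neighbourhood [l0 < l] suffices. The bounds make [F l] finite and positive there, so both
    quotients are ordinary ones. *)
Lemma bigOstar_of_bounds (R : realType) (F : R -> \bar R) (g : R -> R) (a b l0 : R) :
  0 < a ->
  (forall l, l0 < l -> [/\ 0 < g l, ((a * g l)%:E <= F l)%E & (F l <= (b * g l)%:E)%E]) ->
  bigOstar F (fun l => (g l)%:E).
Proof.
move=> a0 H; rewrite /bigOstar.
pose V : set R := [set l | l0 < l].
apply: (@le_lt_trans _ _ (Num.max b a^-1)%:E); last exact: ltry.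
apply: (@le_trans _ _ (ereal_sup ((fun l => maxe `|F l / (g l)%:E| `|(g l)%:E / F l|) @` V)))%E.
  apply: ereal_inf_lbound; exists V => //.
  by exists l0; split=> //; exact: num_real.
apply: ge_ereal_sup => _ [l /= ll <-]; have [g0] := H l ll.
case: (F l) => [e| |]; rewrite ?leye_eq//= => ae eb.
rewrite !lee_fin in ae eb.
have e0 : 0 < e by apply: lt_le_trans ae; rewrite mulr_gt0.
rewrite !inver !gt_eqF// -!EFinM !abse_EFin -EFin_max lee_fin.
rewrite !gtr0_norm ?divr_gt0// ge_max !le_max ler_pdivrMr// eb/=.
by apply/orP; right; rewrite ler_pdivrMr// mulrC ler_pdivlMr// mulrC.
Qed.

Section Growth.
Context {R : realType} (d : R -> measure_display) (Omega : forall l : R, measurableType (d l)).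
Variables (P : forall l : R, probability (Omega l) R) (X : forall l : R, Omega l -> set 'rV[R]_4).
Hypothesis hX : forall l : R, 0 < l -> clifford_poisson_process (P l) l (@X l).

Lemma expected_valence_growth : exists a b l0 : R, 0 < a /\
  forall l, l0 < l -> [/\ 0 < ln l,
    ((a * ln l)%:E <= \int[P l]_w (mean_valence (convex_hull (@X l w)))%:E)%E &
    (\int[P l]_w (mean_valence (convex_hull (@X l w)))%:E <= (b * ln l)%:E)%E].
Proof.
have ln2 : 0 < ln 2 :> R by rewrite ln_gt0// ltr1n.
pose c1 : R := expR (- 20) / 2 ^+ 13.
have c10 : 0 < c1 by rewrite divr_gt0 ?expR_gt0 ?exprn_gt0.
(* The sum of the constants of [expected_valence_le_scale], combined through [k + 2 <= 2 * k]. *)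
pose D : R := 80 * 78 ^+ 4 + 16 * 78 ^+ 2 + 2.
have D0 : 0 < D by rewrite /D !addr_gt0// ?mulr_gt0// exprn_gt0.
(* The summand [2 ^+ 8] forces [k >= 7], so that [q = k - 3] is at least 4 and [q + 4 <= 2 * q]. *)
exists (c1 / (2 * ln 2)), (4 * D / ln 2), ((2 * pi) ^+ 2 + 2 ^+ 8).
split; first by rewrite divr_gt0// mulr_gt0.
move=> l hl.
have pi2 : 4 <= 2 * pi :> R by have := pi_ge2 R; lra.
have pi4 : 16 <= (2 * pi) ^+ 2 :> R.
  by nra.
have e8 : 0 < 2 ^+ 8 :> R by rewrite exprn_gt0.
have l16 : 16 < l by lra.
have l0 : 0 < l by lra.
set L := l * (2 * pi) ^+ 2.
have Ll : l <= L by rewrite /L ler_peMr ?ltW//; lra.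
have L0 : 0 < L by lra.
have [|k kL Lk] := @pow2_bracket R L; first by lra.
have lnL : ln L <= 2 * ln l.
  rewrite /L lnM ?posrE//; last by lra.
  have : ln ((2 * pi) ^+ 2) <= ln l by rewrite ler_ln ?posrE//; lra.
  lra.
have lnl8 : 8 * ln 2 <= ln l.
  by rewrite -[8]/(8%:R) mulr_natl -lnXn// ler_ln ?posrE//; lra.
have kln : k%:R * ln 2 <= 2 * ln l.
  apply: le_trans lnL; rewrite mulr_natl -lnXn// ler_ln ?posrE ?exprn_gt0//.
have kln' : ln l <= k.+1%:R * ln 2.
  apply: (@le_trans _ _ (ln L)); first by rewrite ler_ln ?posrE.
  by rewrite mulr_natl -lnXn// ler_ln ?posrE ?exprn_gt0// ltW.
have k8 : 8 <= k.+1%:R :> R.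
  by rewrite -(ler_pM2r ln2); apply: le_trans lnl8 kln'.
have k7 : (7 <= k)%N by rewrite -ltnS -(ler_nat R).
have lnl0 : 0 < ln l by apply: lt_le_trans lnl8; rewrite mulr_gt0.
split=> //.
  have [q kq] : exists q, k = q.+3 by exists (k - 3)%N; rewrite -addn3 subnK// (leq_trans _ k7).
  rewrite kq in kL Lk kln' k8.
  apply: le_trans (expected_valence_ge l0 (hX l0) erefl kL Lk); rewrite lee_fin -/c1.
  have qk : q.+4%:R <= 2 * q%:R :> R by rewrite -natrM ler_nat; move: k7; rewrite kq; clear; lia.
  rewrite -mulrA mulrC ler_pM2r// mulrC ler_pdivrMr ?mulr_gt0//.
  by apply: (le_trans kln'); rewrite mulrA [_ * 2]mulrC ler_wpM2r// ltW.
have k1 : 7 <= k%:R :> R by rewrite ler_nat.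
have L12 : 12 <= L by lra.
apply: le_trans (expected_valence_le_scale l0 (hX l0) erefl L12 kL Lk) _.
rewrite lee_fin; apply: (@le_trans _ _ (D * (2 * k%:R))).
  rewrite -[in leLHS]addn2 natrD /D; nra.
have -> : 4 * D / ln 2 * ln l = D * (4 * ln l / ln 2) by field; rewrite gt_eqF.
by rewrite ler_pM2l// ler_pdivlMr//; lra.
Qed.

End Growth.

Theorem theorem2p3 (R : realType) (d : R -> measure_display)
    (Omega : forall l : R, measurableType (d l))
    (P : forall l : R, probability (Omega l) R)
    (X : forall l : R, Omega l -> set 'rV[R]_4)
    (hX : forall l : R, 0 < l -> clifford_poisson_process (P l) l (X l)) :
  bigOstar (fun l : R => 'E_(P l)[fun w => mean_valence (convex_hull (X l w))]%E)
           (fun l : R => (ln l)%:E).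
Proof.
have [a [b [l0 [a0 H]]]] := expected_valence_growth hX.
apply: (bigOstar_of_bounds a0 (b := b) (l0 := l0)) => l ll.
by rewrite unlock; exact: H.
Qed.
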